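(* Let $G=\mathrm{SL}(3,\mathbf{R})$ act (locally) on $\mathbf{R}^2$ with coordinates $(x,u)$, where $x$ is the independent and $u$ the dependent variable, by $$(x,u)\longmapsto\Big(\frac{ax+bu+c}{hx+ju+k},\,\frac{dx+eu+f}{hx+ju+k}\Big),\qquad \begin{pmatrix} a & b & c \\ d & e & f \\ h & j & k \end{pmatrix}\in \mathrm{SL}(3,\mathbf{R}),$$ whose infinitesimal generators are spanned by $$\frac{\partial}{\partial x},\ \frac{\partial}{\partial u},\ x\frac{\partial}{\partial x},\ u\frac{\partial}{\partial u},\ x\frac{\partial}{\partial u},\ u\frac{\partial}{\partial x},\ x^2\frac{\partial}{\partial x}+xu\frac{\partial}{\partial u},\ xu\frac{\partial}{\partial x}+u^2\frac{\partial}{\partial u}.$$ Let $i_n, j_n, s_n, h_n$ be the numbers attached to the $n$-th prolonged action of $G$ on the jet space $J^{(n)}$ (defined in the context). Then: (1) $i_0=i_1=\dots=i_6=0$ and $i_n=n-6$ for all $n\ge7$; (2) $j_0=j_1=\dots=j_6=0$ and $j_n=1$ for all $n\ge7$; (3) $s_0=2$, $s_1=3$, $s_2=4$, $s_3=5$, $s_4=6$, $s_5=7$; (4) $h_0=6$, $h_1=5$, $h_2=4$, $h_3=3$, $h_4=2$, $h_5=1$, and $h_n=0$ for all $n\ge6$.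
   Context: The $n$-th jet space $J^{(n)}$ of $\mathbf{R}^2=\mathbf{R}\times\mathbf{R}$ (one independent variable $x$, one dependent variable $u$) is the Euclidean space $\mathbf{R}^{n+2}$ with coordinates $(x,u,u_{(1)},\dots,u_{(n)})$, where $u_{(k)}$ represents the $k$-th derivative of $u$ with respect to $x$ (and $u_{(0)}=u$). The group acts on $J^{(n)}$ by the (local) prolonged action, induced by its action on the $n$-jets of graphs of functions $u=f(x)$. If $v=\xi(x,u)\frac{\partial}{\partial x}+\varphi(x,u)\frac{\partial}{\partial u}$ is an infinitesimal generator of the action on $\mathbf{R}^2$, the corresponding infinitesimal generator of the prolonged action is $$v^{(n)}=\xi\frac{\partial}{\partial x}+\sum_{k=0}^n\varphi^k\frac{\partial}{\partial u_{(k)}},\qquad \varphi^k=D_x^k Q+\xi u_{(k+1)},\quad Q=\varphi-\xi u_{(1)},$$ where $D_x=\frac{\partial}{\partial x}+\sum_{k\ge0}u_{(k+1)}\frac{\partial}{\partial u_{(k)}}$ is the total derivative. The dimension of the orbit through a point of $J^{(n)}$ is the dimension of the span at that point of the prolonged generators $v^{(n)}$. A differential invariant of order at most $n$ is a smooth real-valued function $I$ on an open subset of $J^{(n)}$ that is annihilated by all prolonged infinitesimal generators: $v^{(n)}(I)=0$ for every generator $v$. Invariants $I_1,\dots,I_k$ are functionally independent if $dI_1\wedge\dots\wedge dI_k\ne0$. $s_n$ is the maximal dimension of the orbits of the prolonged action on $J^{(n)}$ (the generic orbit dimension), and $V^{(n)}\subset J^{(n)}$ is the set of points lying on orbits of dimension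 $s_n$. $i_n$ is the maximal number of functionally independent differential invariants of order at most $n$ in a neighbourhood of a point of $V^{(n)}$ (so $i_n=\dim J^{(n)}-s_n$). $j_n=i_n-i_{n-1}$ for $n\ge1$ is the number of strictly functionally independent differential invariants of order $n$, with $j_0=i_0$. $h_n=\dim G-s_n$ is the dimension of the isotropy group, for the prolonged action, of a point of $V^{(n)}$. *)

(* Defs.v *)
From HB Require Import structures.
From mathcomp Require Import all_boot all_order all_algebra.
From mathcomp Require Import all_classical all_reals all_analysis.

Set Implicit Arguments.
Unset Strict Implicit.
Unset Printing Implicit Defensive.

Import Order.TTheory GRing.Theory Num.Theory.
Import numFieldNormedType.Exports.

Local Open Scope classical_set_scope.
Local Open Scope ring_scope.

Section JetSpaces.
Variable R : realType.

(** Jet n is R^(n+2), with coordinates (x, u_(0), ..., u_(n)): column 0 is x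
    and column k+1 is u_(k).  In particular Jet 0 is the (x,u)-plane. *)
Definition Jet (n : nat) : Type := 'rV[R]_(n.+2).

Definition xcoord n (z : Jet n) : R := z 0 0.

(** Only meaningful for k <= n. *)
Definition ucoord n (k : nat) (z : Jet n) : R := z 0 (inord k.+1).

(** For m <= n this is the projection of n-jets onto m-jets; for m > n it
    extends an n-jet by u_(n+1) = ... = u_(m) = 0. *)
Definition jcast n m (z : Jet n) : Jet m :=
  \row_(i < m.+2) if (i < n.+2)%N then z 0 (inord i) else 0.

Definition partial n (i : 'I_(n.+2)) (f : Jet n -> R) (z : Jet n) : R :=
  derive (f : 'rV[R]_(n.+2) -> R^o) z (delta_mx 0 i).

(** The total derivative D_x, taking functions of m-jets to functions of
    (m+1)-jets. *)
Definition Dtot m (F : Jet m -> R) : Jet m.+1 -> R := fun z =>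
  partial ord0 F (jcast m z)
  + \sum_(k < m.+1) ucoord k.+1 z * partial (lift ord0 k) F (jcast m z).

(** A vector field xi d/dx + phi d/du on the plane, as the map (xi, phi). *)
Definition vfield : Type := Jet 0 -> Jet 0.

Definition xi (v : vfield) n (z : Jet n) : R := xcoord (v (jcast 0 z)).

Definition characteristic (v : vfield) : Jet 1 -> R := fun z =>
  ucoord 0 (v (jcast 0 z)) - xi v z * ucoord 1 z.

Fixpoint DQ (v : vfield) (k : nat) : Jet k.+1 -> R :=
  if k is k'.+1 then Dtot (@DQ v k') else characteristic v.

(** The coefficient phi^k = D_x^k Q + xi u_(k+1).  Its two terms live on
    Jet k.+1, but the contributions of u_(k+1) cancel. *)
Definition phi (v : vfield) (k : nat) : Jet k.+1 -> R := fun z =>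
  DQ v z + xi v z * ucoord k.+1 z.

(** The value at z of the prolonged field v^(n).  Since phi^n does not depend
    on u_(n+1), it may be evaluated at the extension of z by u_(n+1) = 0. *)
Definition prolong (v : vfield) n (z : Jet n) : 'rV[R]_(n.+2) :=
  \row_(i < n.+2)
    if unlift ord0 i is Some k then phi v (jcast k.+1 z) else xi v z.

(** v^(n)(I). *)
Definition prolong_apply (v : vfield) n (I : Jet n -> R) (z : Jet n) : R :=
  \sum_(i < n.+2) prolong v z 0 i * partial i I z.

Fixpoint classC n (r : nat) (U : set (Jet n)) (f : Jet n -> R) : Prop :=
  (forall z : 'rV[R]_(n.+2), U z ->
     {for z, continuous (f : 'rV[R]_(n.+2) -> R^o)}) /\
  (if r is r'.+1 then
     forall i : 'I_(n.+2),
       (forall z : 'rV[R]_(n.+2), U z ->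
          derivable (f : 'rV[R]_(n.+2) -> R^o) z (delta_mx 0 i)) /\
       classC r' U (partial i f)
   else True).

Definition smooth_on n (U : set (Jet n)) (f : Jet n -> R) : Prop :=
  forall r, classC r U f.

Section Numbers.
(** The infinitesimal generators of the action on the plane. *)
Variable g : set vfield.

(** d is the dimension of the span of the v^(n) at z, v in g. *)
Definition orbit_dim n (z : Jet n) (d : nat) : Prop :=
  exists X : seq 'rV[R]_(n.+2),
    [/\ forall w, w \in X -> exists2 v, g v & w = prolong v z,
        forall v, g v -> prolong v z \in <<X>>%VS
      & \dim <<X>>%VS = d].

(** s_n = s *)
Definition generic_orbit_dim (n s : nat) : Prop :=
  (exists z : Jet n, orbit_dim z s) /\
  (forall (z : Jet n) d, orbit_dim z d -> (d <= s)%N).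

(** z belongs to V^(n) *)
Definition regular_jet n (z : Jet n) : Prop :=
  exists2 s, generic_orbit_dim n s & orbit_dim z s.

Definition diff_invariant n (U : set (Jet n)) (I : Jet n -> R) : Prop :=
  smooth_on U I /\
  forall v, g v -> forall z, U z -> prolong_apply v I z = 0.

(** dI_1 /\ ... /\ dI_k <> 0 at every point of U, that is, the differentials
    are linearly independent there. *)
Definition funct_indep n (U : set (Jet n)) k (I : 'I_k -> Jet n -> R) : Prop :=
  forall z, U z -> row_free (\matrix_(a < k, i < n.+2) partial i (I a) z).

Definition has_indep_invariants n (p : Jet n) (k : nat) : Prop :=
  exists (U : set 'rV[R]_(n.+2)) (I : 'I_k -> Jet n -> R),
    [/\ open U, U p, forall a, diff_invariant U (I a) & funct_indep U I].

(** i_n = i: the maximal number of functionally independent invariants near p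
    is i, whichever the point p of V^(n). *)
Definition inv_number (n i : nat) : Prop :=
  (exists p : Jet n, regular_jet p) /\
  forall p : Jet n, regular_jet p ->
    has_indep_invariants p i /\
    forall k, has_indep_invariants p k -> (k <= i)%N.

(** j_n = j *)
Definition strict_inv_number (n : nat) (j : int) : Prop :=
  if n is m.+1 then
    exists i i' : nat,
      [/\ inv_number n i, inv_number m i' & j = i%:Z - i'%:Z]
  else exists2 i : nat, inv_number 0 i & j = i%:Z.

(** h_n = h, for a group of dimension dimG *)
Definition isotropy_dim (dimG n : nat) (h : int) : Prop :=
  exists2 s : nat, generic_orbit_dim n s & h = dimG%:Z - s%:Z.

End Numbers.

Definition mkpt (a b : R) : Jet 0 := \row_(i < 2) if i == 0 then a else b.

(** The (local) action of SL(3,R) on the plane; it is defined where the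
    denominator does not vanish. *)
Definition proj_act (A : 'M[R]_3) (p : Jet 0) : Jet 0 :=
  let w i := A i 0 * xcoord p + A i 1 * ucoord 0 p + A i 2%:R in
  mkpt (w 0 / w 2%:R) (w 1 / w 2%:R).

(** The infinitesimal generators: the velocity fields, at t = 0, of the action
    along the curves of SL(3,R) that start from the identity. *)
Definition sl3_generators : set vfield := [set v |
  exists c : R -> 'M[R]_3,
    [/\ forall t, \det (c t) = 1,
        c 0 = 1%:M,
        derivable (c : R^o -> 'M[R]_3) 0 1
      & forall p : Jet 0,
          is_derive (0 : R^o) 1
            ((fun t => proj_act (c t) p) : R^o -> 'rV[R]_2) (v p)]].

(** The dimension of SL(3,R), as that of its Lie algebra, the trace-zero
    matrices. *)
Definition dimSL3 : nat :=
  \dim (lker (linfun (@mxtrace R 3 : 'M[R]_3 -> R^o))).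

Definition sl3_fields : seq vfield :=
  [:: (fun=> mkpt 1 0);
      (fun=> mkpt 0 1);
      (fun p => mkpt (xcoord p) 0);
      (fun p => mkpt 0 (ucoord 0 p));
      (fun p => mkpt 0 (xcoord p));
      (fun p => mkpt (ucoord 0 p) 0);
      (fun p => mkpt (xcoord p ^+ 2) (xcoord p * ucoord 0 p));
      (fun p => mkpt (xcoord p * ucoord 0 p) (ucoord 0 p ^+ 2))].

Definition spanned_by_fields (s : seq vfield) (v : vfield) : Prop :=
  exists c : 'I_(size s) -> R,
    forall p : Jet 0,
      v p = \sum_(i < size s)
              c i *: (nth (fun=> 0 : 'rV[R]_2) s i p : 'rV[R]_2) :> 'rV[R]_2.

End JetSpaces.

(* Main.v *)
Require Import Defs.
From HB Require Import structures.
From mathcomp Require Import all_boot all_order all_algebra.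
From mathcomp Require Import all_classical all_reals all_analysis.
From mathcomp Require Import ring lra zify perm.

Set Implicit Arguments.
Unset Strict Implicit.
Unset Printing Implicit Defensive.

Import Order.TTheory GRing.Theory Num.Theory.
Import numFieldNormedType.Exports.

Local Open Scope classical_set_scope.
Local Open Scope ring_scope.

(** At an n-jet z, the span of the prolonged generators is the row space of a
    matrix with 8 rows and n+2 columns ([generator_mx]), because the generators
    are the fields [proj_field B] of 3 x 3 matrices B modulo scalars.  So s_n is
    at most min(8, n+2), and the jets of u = x^2 + x^5 at the origin reach this
    bound ([witness_free], [witness_full]).  This gives s_n and h_n.

    The differentials of invariants at a jet annihilate the span of the
    generators, which leaves room for at most n+2-s_n independent invariants
    ([invariants_le]).  For n <= 6 this is zero.

    For n >= 7 the n-6 invariants have to be found near every jet p whose orbit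
    has dimension 8, including jets of inflection or sextactic points, where the
    classical projective differential invariants degenerate.  This is the
    theorem of Frobenius, and the group itself provides the integral manifolds:
    the chart (A, sigma) |-> A . (p + sigma C), where A runs through the group
    near the identity and p + sigma C through an affine section transversal to
    the orbit of p, is invertible at (1, 0), and the components sigma of its
    local inverse are locally constant on orbits.  Three facts carry the argument.

    - The derivatives of the chart in the entries of A are prolonged generators
      ([eval_der_gpar_U]): the jet of the image curve is computed by
      u_(m+1) = u_(m)' / x', differentiation in A commutes with differentiation
      along the curve, and this reproduces the recursion for the coefficients
      phi^k.

    - A rational map has a local inverse where its Jacobian matrix is invertible
      ([local_inverse]), by Banach's fixed point theorem.

    - The local inverse is smooth ([smooth_chi]): its derivatives are rational
      functions of its values, so the functions rational in its values are closed
      under partial differentiation. *)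

(** * Derivatives along lines and of matrix-valued functions *)

Section DerivativeAlongLines.
Variable R : realType.

Lemma is_derive_lineE (N : nat) (f : 'rV[R]_N -> R) (z v : 'rV[R]_N) (d : R) :
  is_derive z v (f : _ -> R^o) d <->
  is_derive (0 : R^o) 1 ((fun h => f (h *: v + z)) : R^o -> R^o) d.
Proof.
have E : (fun h : R => h^-1 *: (((f : _ -> R^o) \o shift z) (h *: v) - f z)) =
  (fun h : R => h^-1 *: ((((fun h => f (h *: v + z)) : R^o -> R^o) \o shift 0)
       (h *: 1) - f (0 *: v + z))).
  by apply/funext => h /=; rewrite addr0 scale0r add0r [h *: 1]mulr1.
by split=> -[H1 H2]; split; move: H1 H2; rewrite /derivable /derive /= E.
Qed.

Lemma is_derive_mxP (m n : nat) (f : R -> 'M[R]_(m, n)) (t : R) (d : 'M[R]_(m, n)) :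
  is_derive (t : R^o) 1 (f : R^o -> _) d <->
  forall i j, is_derive (t : R^o) 1 ((fun h => f h i j) : R^o -> R^o) (d i j).
Proof.
split=> [[fd <-] i j|fd].
  split; first by move: (fd) => /derivable_mxP; exact.
  by rewrite derive_mx// mxE.
have dv : derivable (f : R^o -> _) t 1.
  by apply/derivable_mxP => i j; have [] := fd i j.
split=> //; rewrite derive_mx//; apply/matrixP => i j; rewrite mxE.
by have [] := fd i j.
Qed.

Lemma is_derive_uniq (V W : normedModType R) (f : V -> W) (x v : V) d d' :
  is_derive x v f d -> is_derive x v f d' -> d = d'.
Proof. by move=> [_ <-] [_ <-]. Qed.

End DerivativeAlongLines.

(** * Rational expressions and their formal derivatives *)

Section Expressions.
Variable R : realType.

(** The functions to be differentiated on the jet spaces and on the group are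
    rational in finitely many variables.  Representing them syntactically makes
    their partial derivatives expressions again, so that smoothness, the
    symmetry of mixed derivatives and the factorization of increments are
    proved by structural induction. *)
Inductive expr (V : Type) : Type :=
| EVar of V | ECst of R | EAdd of expr V & expr V | EMul of expr V & expr V
| EInv of expr V.

Fixpoint eval (V : Type) (e : expr V) (r : V -> R) : R :=
  match e with
  | EVar i => r i | ECst c => c
  | EAdd a b => eval a r + eval b r | EMul a b => eval a r * eval b r
  | EInv a => (eval a r)^-1
  end.

(** No denominator that occurs in [e] vanishes at [r]. *)
Fixpoint wd (V : Type) (e : expr V) (r : V -> R) : Prop :=
  match e with
  | EVar _ | ECst _ => True
  | EAdd a b | EMul a b => wd a r /\ wd b r
  | EInv a => wd a r /\ eval a r != 0
  end.

Fixpoint der (V : eqType) (j : V) (e : expr V) : expr V :=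
  match e with
  | EVar i => ECst V (i == j)%:R | ECst _ => ECst V 0
  | EAdd a b => EAdd (der j a) (der j b)
  | EMul a b => EAdd (EMul (der j a) b) (EMul a (der j b))
  | EInv a => EMul (EMul (ECst V (-1)) (der j a)) (EMul (EInv a) (EInv a))
  end.

Fixpoint bind (V W : Type) (e : expr V) (s : V -> expr W) : expr W :=
  match e with
  | EVar i => s i | ECst c => ECst W c
  | EAdd a b => EAdd (bind a s) (bind b s)
  | EMul a b => EMul (bind a s) (bind b s)
  | EInv a => EInv (bind a s)
  end.

Definition esum (V : Type) (I : Type) (s : seq I) (F : I -> expr V) : expr V :=
  foldr (fun i => EAdd (F i)) (ECst V 0) s.

Definition eprod (V : Type) (I : Type) (s : seq I) (F : I -> expr V) : expr V :=
  foldr (fun i => EMul (F i)) (ECst V 1) s.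

Lemma eval_ext (V : Type) (e : expr V) r r' : r =1 r' -> eval e r = eval e r'.
Proof. by move=> h; congr eval; apply/funext. Qed.

Lemma eval_esum (V I : Type) (s : seq I) (F : I -> expr V) r :
  eval (esum s F) r = \sum_(i <- s) eval (F i) r.
Proof. by elim: s => [|i s IH] /=; rewrite ?big_nil// big_cons IH. Qed.

Lemma eval_eprod (V I : Type) (s : seq I) (F : I -> expr V) r :
  eval (eprod s F) r = \prod_(i <- s) eval (F i) r.
Proof. by elim: s => [|i s IH] /=; rewrite ?big_nil// big_cons IH. Qed.

Lemma wd_esum (V I : Type) (s : seq I) (F : I -> expr V) r :
  (forall i, wd (F i) r) -> wd (esum s F) r.
Proof. by move=> h; elim: s => //= i s IH. Qed.

Lemma wd_eprod (V I : Type) (s : seq I) (F : I -> expr V) r :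
  (forall i, wd (F i) r) -> wd (eprod s F) r.
Proof. by move=> h; elim: s => //= i s IH. Qed.

Lemma der_esum (V : eqType) (I : Type) (s : seq I) (F : I -> expr V) j :
  der j (esum s F) = esum s (fun i => der j (F i)).
Proof. by elim: s => //= i s ->. Qed.

Lemma wd_der (V : eqType) (j : V) (e : expr V) r : wd e r -> wd (der j e) r.
Proof.
elim: e => //= [a IHa b IHb [/[dup] wa /IHa ? /[dup] wb /IHb ?]|
  a IHa b IHb [/[dup] wa /IHa ? /[dup] wb /IHb ?]|a IHa [/[dup] wa /IHa ? ?]].
- by split.
- by split; split.
- by split; split.
Qed.

Lemma eval_bind (V W : Type) (e : expr V) (s : V -> expr W) r :
  eval (bind e s) r = eval e (fun v => eval (s v) r).
Proof. by elim: e => //= [a -> b ->|a -> b ->|a ->]. Qed.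

Lemma wd_bind (V W : Type) (e : expr V) (s : V -> expr W) r :
  (forall v, wd (s v) r) -> wd e (fun v => eval (s v) r) -> wd (bind e s) r.
Proof.
move=> ws; elim: e => //= [a IHa b IHb [/IHa ? /IHb ?]|
   a IHa b IHb [/IHa ? /IHb ?]|a IHa [/IHa ? ?]].
- by split.
- by split.
- by rewrite eval_bind.
Qed.

(** The symmetry of mixed partial derivatives is a formal identity, in which the
    inverses of the denominators are just further variables. *)
Lemma der_comm (V : eqType) (i j : V) (e : expr V) r :
  eval (der i (der j e)) r = eval (der j (der i e)) r.
Proof.
elim: e => //= [a -> b ->|a IHa b IHb|a IHa] //=.
- by rewrite IHa IHb; ring.
- by rewrite IHa; ring.
Qed.

(** The chain rule along a curve in the space of values of the variables. *)
Lemma is_derive_eval (V : finType) (e : expr V) (r : R -> V -> R) (t : R)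
    (d : V -> R) :
  (forall v, is_derive (t : R^o) 1 ((fun h => r h v) : R^o -> R^o) (d v)) ->
  wd e (r t) ->
  is_derive (t : R^o) 1 ((fun h => eval e (r h)) : R^o -> R^o)
    (\sum_v eval (der v e) (r t) * d v).
Proof.
move=> dr; elim: e => [v|c|a IHa b IHb|a IHa b IHb|a IHa] /=.
- move=> _; apply: is_derive_eq; rewrite (bigD1 v)//= eqxx mul1r big1 ?addr0//.
  by move=> w /negPf wv; rewrite eq_sym wv mul0r.
- move=> _; apply: is_derive_eq (is_derive_cst _ _ _) _.
  by rewrite big1// => w _; rewrite mul0r.
- move=> [/IHa{IHa} IHa /IHb{IHb} IHb].
  apply: is_derive_eq (is_deriveD IHa IHb) _.
  by rewrite -big_split/=; apply: eq_bigr => w _; ring.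
- move=> [/IHa{IHa} IHa /IHb{IHb} IHb].
  apply: is_derive_eq (is_deriveM IHa IHb) _.
  rewrite /GRing.scale/= !mulr_sumr -big_split/=.
  by apply: eq_bigr => w _; ring.
- move=> [/IHa{IHa} IHa a0].
  have [H1 H2] := IHa.
  have H := derivableV a0 H1.
  split=> //; rewrite deriveV// H2 /GRing.scale/= mulr_sumr.
  by apply: eq_bigr => w _; rewrite -exprVn; ring.
Qed.

Lemma der_bind (V : finType) (W : eqType) (j : W) (e : expr V) (s : V -> expr W) r :
  eval (der j (bind e s)) r =
  \sum_v eval (der v e) (fun v => eval (s v) r) * eval (der j (s v)) r.
Proof.
elim: e => [v|c|a IHa b IHb|a IHa b IHb|a IHa] /=.
- rewrite (bigD1 v)//= eqxx mul1r big1 ?addr0//.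
  by move=> w /negPf wv; rewrite eq_sym wv mul0r.
- by rewrite big1// => w _; rewrite mul0r.
- by rewrite IHa IHb -big_split/=; apply: eq_bigr => w _; ring.
- rewrite IHa IHb !eval_bind mulr_suml mulr_sumr -big_split/=.
  by apply: eq_bigr => w _; ring.
- rewrite IHa !eval_bind mulr_sumr mulr_suml.
  by apply: eq_bigr => w _; ring.
Qed.

(** Hadamard's quotients: [dq v e] is an expression in two points, and the
    increment of [e] between them is the sum over [v] of [dq v e] times the
    increment of the variable [v].  On the diagonal it is a partial
    derivative.  The variables of the first point are tagged by [inl], those of
    the second by [inr]. *)
Fixpoint dq (V : eqType) (j : V) (e : expr V) : expr (V + V) :=
  match e with
  | EVar i => ECst _ (i == j)%:R | ECst _ => ECst _ 0
  | EAdd a b => EAdd (dq j a) (dq j b)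
  | EMul a b => EAdd (EMul (dq j a) (bind b (fun v => EVar (inl v))))
                     (EMul (bind a (fun v => EVar (inr v))) (dq j b))
  | EInv a => EMul (EMul (ECst _ (-1)) (dq j a))
      (EMul (EInv (bind a (fun v => EVar (inl v))))
            (EInv (bind a (fun v => EVar (inr v)))))
  end.

Definition pair_env (V : Type) (r r' : V -> R) (w : V + V) : R :=
  match w with inl v => r v | inr v => r' v end.

Lemma wd_dq (V : eqType) (j : V) (e : expr V) r r' :
  wd e r -> wd e r' -> wd (dq j e) (pair_env r r').
Proof.
elim: e => //= [a IHa b IHb [? ?] [? ?]|a IHa b IHb [? ?] [? ?]|a IHa [? ?] [? ?]].
- by split; [exact: IHa|exact: IHb].
- by do !split; try exact: IHa; try exact: IHb; exact: wd_bind.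
- by do !split; try exact: IHa; rewrite ?eval_bind//; exact: wd_bind.
Qed.

Lemma dq_diag (V : eqType) (j : V) (e : expr V) r :
  eval (dq j e) (pair_env r r) = eval (der j e) r.
Proof.
by elim: e => //= [a -> b ->|a -> b ->|a ->]; rewrite ?eval_bind.
Qed.

(** This exact identity stands for the mean value inequality and for strict
    differentiability. *)
Lemma dq_telescope (V : finType) (e : expr V) r r' : wd e r -> wd e r' ->
  eval e r - eval e r' = \sum_v eval (dq v e) (pair_env r r') * (r v - r' v).
Proof.
elim: e => [v|c|a IHa b IHb|a IHa b IHb|a IHa] /=.
- move=> _ _; rewrite (bigD1 v)//= eqxx mul1r big1 ?addr0//.
  by move=> w /negPf wv; rewrite eq_sym wv mul0r.
- by move=> _ _; rewrite subrr big1// => w _; rewrite mul0r.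
- move=> [? ?] [? ?]; rewrite opprD addrACA IHa// IHb// -big_split/=.
  by apply: eq_bigr => w _; ring.
- move=> [? ?] [? ?].
  transitivity ((eval a r - eval a r') * eval b r
     + eval a r' * (eval b r - eval b r')); first by ring.
  rewrite IHa// IHb// mulr_suml mulr_sumr -big_split/=.
  by apply: eq_bigr => w _; rewrite !eval_bind/=; ring.
- move=> [wa a0] [wa' a'0].
  transitivity (- (eval a r - eval a r') * ((eval a r)^-1 * (eval a r')^-1)).
    by field; rewrite a0 a'0.
  rewrite IHa// mulNr mulr_suml -sumrN.
  by apply: eq_bigr => w _; rewrite !eval_bind/=; ring.
Qed.

Lemma cvg_eval (V : Type) (e : expr V) (T : Type) (F : set_system T)
    {FF : Filter F} (r : T -> V -> R) (r0 : V -> R) :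
  (forall v, (fun x => r x v : R^o) @ F --> (r0 v : R^o)) -> wd e r0 ->
  (fun x => eval e (r x) : R^o) @ F --> (eval e r0 : R^o).
Proof.
move=> cr; elim: e => [v _|c _|a IHa b IHb|a IHa b IHb|a IHa] /=.
- exact: cr.
- exact: cvg_cst.
- by move=> [/IHa ha /IHb hb]; exact: cvgD.
- by move=> [/IHa ha /IHb hb]; exact: cvgM.
- by move=> [/IHa ha a0]; exact: cvgV.
Qed.

Lemma near_wd (V : Type) (e : expr V) (T : Type) (F : set_system T)
    {FF : Filter F} (r : T -> V -> R) (r0 : V -> R) :
  (forall v, (fun x => r x v : R^o) @ F --> (r0 v : R^o)) -> wd e r0 ->
  \forall x \near F, wd e (r x).
Proof.
move=> cr; elim: e => [v _|c _|a IHa b IHb|a IHa b IHb|a IHa] /=.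
- exact: nearW.
- exact: nearW.
- by move=> [/IHa ha /IHb hb]; near=> x; split; near: x.
- by move=> [/IHa ha /IHb hb]; near=> x; split; near: x.
- move=> [wa a0]; have ha := IHa wa.
  have ca := cvgr_neq0 _ (cvg_eval cr wa) a0.
  by apply: filterS2 ha (ca FF FF) => x ? ?; split.
Unshelve. all: by end_near. Qed.

Definition edet (V : Type) (n : nat) (E : 'I_n -> 'I_n -> expr V) : expr V :=
  esum (enum 'S_n) (fun s => EMul (ECst V ((-1) ^+ odd_perm s))
     (eprod (enum 'I_n) (fun i => E i (s i)))).

Lemma eval_edet (V : Type) (n : nat) (E : 'I_n -> 'I_n -> expr V) r :
  eval (edet E) r = \det (\matrix_(i, j) eval (E i j) r).
Proof.
rewrite eval_esum big_enum/=; apply: eq_big => // s _ /=.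
by rewrite eval_eprod big_enum/=; congr (_ * _); apply: eq_bigr => i _; rewrite mxE.
Qed.

(** The entry (i, j) of the inverse of the generic matrix, by Cramer's rule. *)
Definition einv (n : nat) (i j : 'I_n) : expr ('I_n * 'I_n) :=
  EMul (EInv (edet (fun a b => EVar (a, b))))
  (EMul (ECst _ ((-1) ^+ (j + i)))
     (edet (fun a b => EVar (lift j a, lift i b)))).

Definition mx_env (n : nat) (A : 'M[R]_n) (w : 'I_n * 'I_n) : R := A w.1 w.2.

Lemma wd_edet (V : Type) (n : nat) (E : 'I_n -> 'I_n -> expr V) r :
  (forall i j, wd (E i j) r) -> wd (edet E) r.
Proof.
by move=> h; apply: wd_esum => s /=; split=> //; exact: wd_eprod.
Qed.

Lemma eval_einv (n : nat) (A : 'M[R]_n) i j : A \in unitmx ->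
  eval (einv i j) (mx_env A) = invmx A i j.
Proof.
move=> uA; rewrite /einv /= /invmx uA !mxE; congr (_ * _).
  rewrite eval_edet; congr (_^-1); congr (\det _).
  by apply/matrixP => a b; rewrite !mxE.
rewrite eval_edet /cofactor; congr (_ * \det _).
by apply/matrixP => a b; rewrite !mxE.
Qed.

Lemma wd_einv (n : nat) (A : 'M[R]_n) i j : A \in unitmx ->
  wd (einv i j) (mx_env A).
Proof.
move=> uA; split; last by split=> //; apply: wd_edet.
split; first exact: wd_edet.
rewrite eval_edet; move: uA; rewrite unitmxE unitfE.
by congr (\det _ != 0); apply/matrixP => a b; rewrite !mxE.
Qed.

End Expressions.

(** * The maximum norm on row vectors *)

HB.instance Definition _ (R : realType) (m n : nat) :=
  Uniform_isComplete.Build 'M[R]_(m, n) (@cauchy_cvg _).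

Section RowVectorNorm.
Variables (R : realType) (N : nat).
Implicit Types (v : 'rV[R]_N) (A : 'M[R]_N).

Lemma coord_le_norm v i : `|v 0 i| <= `|v|.
Proof. by rewrite [leRHS]/Num.Def.normr/= mx_normrE (le_bigmax _ _ (0, i)). Qed.

Lemma norm_le_coord v (c : R) : 0 <= c -> (forall i, `|v 0 i| <= c) -> `|v| <= c.
Proof.
move=> c0 h; rewrite [leLHS]/Num.Def.normr/= mx_normrE (bigmax_le _ c0)// => -[i j] _.
by rewrite /= ord1.
Qed.

Lemma norm_mulmx_le v A (c : R) : (forall i j, `|A i j| <= c) ->
  `|v *m A| <= N%:R * c * `|v|.
Proof.
move=> h.
have [i0 _|n0] := pickP 'I_N; last first.
  have -> : v *m A = 0 by apply/rowP => j; have := n0 j.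
  have -> : v = 0 by apply/rowP => j; have := n0 j.
  by rewrite normr0 mulr0.
have c0 : 0 <= c by apply: le_trans (h i0 i0).
apply: norm_le_coord => [|j]; first by rewrite !mulr_ge0.
rewrite mxE; apply: le_trans (ler_norm_sum _ _ _) _.
apply: le_trans (_ : \sum_(i < N) c * `|v| <= _); last first.
  by rewrite sumr_const card_ord -[leLHS]mulr_natl mulrA.
by apply: ler_sum => i _; rewrite normrM mulrC ler_pM// coord_le_norm.
Qed.

Lemma mx_entries_bounded A : exists2 c, 0 < c & forall i j, `|A i j| <= c.
Proof.
exists (1 + `|A|) => [|i j]; first by rewrite ltr_pwDl.
apply: (@le_trans _ _ `|A|); last by rewrite lerDr.
by rewrite [leRHS]/Num.Def.normr/= mx_normrE (le_bigmax _ _ (i, j)).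
Qed.

Lemma cvg_coord (T : Type) (F : set_system T) {FF : Filter F}
    (f : T -> 'rV[R]_N) v i :
  f @ F --> v -> (fun x => f x 0 i : R^o) @ F --> (v 0 i : R^o).
Proof.
move=> fv; apply/cvgrPdist_le => e e0.
move/cvgrPdist_le : fv => /(_ e e0); apply: filterS => x; apply: le_trans.
by have := coord_le_norm (v - f x) i; rewrite !mxE.
Qed.

Lemma nbhs_pair_closed_ball v (P : set ('rV[R]_N * 'rV[R]_N)) :
  nbhs (v, v) P -> exists2 r, 0 < r &
   forall y y', `|y - v| <= r -> `|y' - v| <= r -> P (y, y').
Proof.
move=> /nbhs_ballP[e /= e0 eP]; exists (e / 2) => [|y y' hy hy'].
  by rewrite divr_gt0.
have e2 : e / 2 < e by rewrite ltr_pdivrMr// ltr_pMr// ltr1n.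
apply: eP; split; rewrite /= -ball_normE /= distrC.
  exact: le_lt_trans hy e2.
exact: le_lt_trans hy' e2.
Qed.

End RowVectorNorm.

(** * The local inverse of a rational map *)

Section LocalInverse.
Variables (R : realType) (N : nat) (Psi : 'I_N -> expr R 'I_N).

Definition rv (y : 'rV[R]_N) : 'I_N -> R := fun i => y 0 i.

Definition emap (y : 'rV[R]_N) : 'rV[R]_N := \row_b eval (Psi b) (rv y).

Definition ejac (y : 'rV[R]_N) : 'M[R]_N :=
  \matrix_(j, b) eval (der j (Psi b)) (rv y).

(** The increment of [emap] is the increment of the point times this matrix,
    which is the Jacobian matrix on the diagonal. *)
Definition eslope (y y' : 'rV[R]_N) : 'M[R]_N :=
  \matrix_(j, b) eval (dq j (Psi b)) (pair_env (rv y) (rv y')).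

Definition regular_pt (y : 'rV[R]_N) : Prop :=
  (forall b, wd (Psi b) (rv y)) /\ ejac y \in unitmx.

Lemma emap_sub y y' :
  (forall b, wd (Psi b) (rv y)) -> (forall b, wd (Psi b) (rv y')) ->
  emap y - emap y' = (y - y') *m eslope y y'.
Proof.
move=> w w'; apply/rowP => b; rewrite !mxE dq_telescope//.
by apply: eq_bigr => j _; rewrite !mxE mulrC.
Qed.

Lemma eslope_diag y : eslope y y = ejac y.
Proof. by apply/matrixP => j b; rewrite !mxE dq_diag. Qed.

Lemma cvg_eslope (T : Type) (F : set_system T) {FF : Filter F}
    (f g : T -> 'rV[R]_N) y :
  (forall b, wd (Psi b) (rv y)) -> f @ F --> y -> g @ F --> y ->
  forall i j, (fun x => eslope (f x) (g x) i j : R^o) @ F --> (ejac y i j : R^o).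
Proof.
move=> w fy gy i j; rewrite -eslope_diag.
under eq_fun do rewrite mxE.
rewrite mxE; apply: cvg_eval; last exact: wd_dq.
by move=> [a|a] /=; exact: cvg_coord.
Qed.

Lemma cvg_invmx (T : Type) (F : set_system T) {FF : Filter F}
    (f : T -> 'M[R]_N) A :
  A \in unitmx ->
  (forall i j, (fun x => f x i j : R^o) @ F --> (A i j : R^o)) ->
  (\forall x \near F, f x \in unitmx) /\
  (forall i j, (fun x => invmx (f x) i j : R^o) @ F --> (invmx A i j : R^o)).
Proof.
move=> uA fA.
have fA' (w : 'I_N * 'I_N) :
    (fun x => mx_env (f x) w : R^o) @ F --> (mx_env A w : R^o) by exact: fA.
have nu : \forall x \near F, f x \in unitmx.
  have wA : wd (edet (fun a b => EVar R (a, b))) (mx_env A) by exact: wd_edet.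
  have E (B : 'M[R]_N) : eval (edet (fun a b => EVar R (a, b))) (mx_env B) = \det B.
    by rewrite eval_edet; congr (\det _); apply/matrixP => a b; rewrite mxE.
  have := cvgr_neq0 _ (cvg_eval fA' wA).
  rewrite E -unitfE -unitmxE => /(_ _ _ uA) H.
  by apply: filterS H => x; rewrite E unitmxE unitfE.
split=> // i j.
have H := cvg_eval fA' (wd_einv i j uA); rewrite eval_einv// in H.
refine (cvg_trans _ (H FF)); apply: near_eq_cvg.
by apply: filterS nu => x /(eval_einv i j).
Qed.

(** With K the inverse of the Jacobian matrix J at [y0], the preimage of z is the
    fixed point of y |-> y - (emap y - z) K.  Two values of this map differ by
    (y - y') (J - S) K, where S is the matrix of slopes; S is close to J near
    [y0], so the map is a contraction.  The contraction estimate also makes the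
    inverse [chi] Lipschitz, and chi z' - chi z = (z' - z) S^-1 gives its
    derivatives, since S tends to the Jacobian matrix. *)
Theorem local_inverse (y0 : 'rV[R]_N) (W : set 'rV[R]_N) :
  regular_pt y0 -> nbhs y0 W ->
  exists (U : set 'rV[R]_N) (chi : 'rV[R]_N -> 'rV[R]_N),
    [/\ open U, U (emap y0) &
    forall z, U z ->
     [/\ W (chi z), regular_pt (chi z), emap (chi z) = z,
         {for z, continuous chi}
       & forall i j, is_derive z (delta_mx 0 i) ((fun z => chi z 0 j) : _ -> R^o)
                       (invmx (ejac (chi z)) i j)]].
Proof.
move=> [wd0 u0] nW.
set z0 := emap y0; set J := ejac y0 in u0; set K := invmx J.
have [c c0 Kc] := mx_entries_bounded K.
pose L := N%:R * c.
have L0 : 0 <= L by rewrite mulr_ge0// ltW.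
pose eps := (2 * (1 + N%:R * L))^-1.
have eps0 : 0 < eps by rewrite invr_gt0 mulr_gt0// ltr_pwDl// mulr_ge0.
have frac_le (M : R) : 0 <= M -> M / (1 + M) <= 1.
  by move=> M0; rewrite ler_pdivrMr ?ltr_pwDl// mul1r lerDr.
have epsL : N%:R * L * eps <= 2^-1.
  rewrite /eps invfM mulrCA ler_piMr ?invr_ge0//.
  by apply: frac_le; rewrite mulr_ge0.
have c1 : fst @ nbhs (y0, y0) --> y0 by exact: cvg_fst.
have c2 : snd @ nbhs (y0, y0) --> y0 by exact: cvg_snd.
have c1' i : (fun x : 'rV[R]_N * 'rV[R]_N => x.1 0 i : R^o) @ nbhs (y0, y0)
    --> (y0 0 i : R^o) by exact: cvg_coord.
have cQ i j : (fun x : 'rV[R]_N * 'rV[R]_N => eslope x.1 x.2 i j : R^o) @ nbhs (y0, y0)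
    --> (J i j : R^o) by exact: cvg_eslope.
have [nQ _] := cvg_invmx u0 cQ.
have [r r0 Hr] : exists2 r, 0 < r & forall y y', `|y - y0| <= r -> `|y' - y0| <= r ->
    [/\ W y, forall b, wd (Psi b) (rv y), eslope y y' \in unitmx &
     forall i j, `|(J - eslope y y') i j| <= eps].
  have n1 : \forall x \near (y0, y0), W x.1 by apply: c1.
  have n2 : \forall x \near (y0, y0), forall b, wd (Psi b) (rv x.1).
    refine (@filter_forall _ _ (fun b (x : 'rV[R]_N * 'rV[R]_N) =>
       wd (Psi b) (rv x.1)) (nbhs (y0, y0)) _ _) => b.
    exact: (@near_wd _ _ (Psi b) _ (nbhs (y0, y0)) _
       (fun x : 'rV[R]_N * 'rV[R]_N => rv x.1) (rv y0) c1' (wd0 b)).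
  have n3 : \forall x \near (y0, y0), forall w : 'I_N * 'I_N,
      `|(J - eslope x.1 x.2) w.1 w.2| <= eps.
    refine (@filter_forall _ _ (fun w (x : 'rV[R]_N * 'rV[R]_N) =>
      `|(J - eslope x.1 x.2) w.1 w.2| <= eps) (nbhs (y0, y0)) _ _) => -[i j] /=.
    have /cvgrPdist_le/(_ _ eps0) := cQ i j.
    by apply: filterS => x; rewrite !mxE.
  have [r r0 H] := nbhs_pair_closed_ball (filterI (filterI n1 n2) (filterI nQ n3)).
  exists r => // y y' hy hy'; have [[? ?] [? h]] := H y y' hy hy'.
  by split=> // i j; exact: (h (i, j)).
have ball0 : `|y0 - y0| <= r by rewrite subrr normr0 ltW.
(* [eps] was chosen so that (J - S) K has operator norm at most 1/2 *)
have contr (v : 'rV[R]_N) y y' : `|y - y0| <= r -> `|y' - y0| <= r ->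
    `|v *m (J - eslope y y') *m K| <= 2^-1 * `|v|.
  move=> hy hy'; have [_ _ _ hE] := Hr y y' hy hy'.
  apply: le_trans (norm_mulmx_le _ Kc) _.
  apply: le_trans (ler_wpM2l L0 (norm_mulmx_le _ hE)) _.
  have -> : L * (N%:R * eps * `|v|) = (N%:R * L * eps) * `|v| by ring.
  by rewrite ler_wpM2r.
pose T z y := y - (emap y - z) *m K.
have TB z y y' : `|y - y0| <= r -> `|y' - y0| <= r ->
   T z y - T z y' = (y - y') *m (J - eslope y y') *m K.
  move=> hy hy'; have [_ w _ _] := Hr y y' hy hy'; have [_ w' _ _] := Hr y' y hy' hy.
  rewrite mulmxBr mulmxBl -mulmxA mulmxV// mulmx1 -emap_sub// /T.
  rewrite !mulmxBl; move: (emap y *m K) (emap y' *m K) (z *m K) => a b d.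
  by apply/rowP => i; rewrite !mxE; ring.
pose rho := r / (2 * (1 + L)).
have rho0 : 0 < rho by rewrite divr_gt0// mulr_gt0// ltr_pwDl.
have ex z : exists y, `|z - z0| < rho -> `|y - y0| <= r /\ emap y = z.
  have [zr|] := ltP `|z - z0| rho; last by exists y0.
  pose B := closed_ball y0 r.
  have BE y : B y <-> `|y - y0| <= r.
    by rewrite /B closed_ballE// /closed_ball_ /= distrC.
  have TBB : {homo T z : y / B y >-> B y}.
    move=> y /BE hy; apply/BE.
    have -> : T z y - y0 = (T z y - T z y0) + (T z y0 - y0) by rewrite addrA subrK.
    apply: le_trans (ler_normD _ _) _; rewrite TB//.
    have -> : T z y0 - y0 = (z - z0) *m K.
      by rewrite /T -/z0 addrAC subrr sub0r -mulNmx opprB.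
    rewrite [leRHS](splitr r); apply: lerD.
      apply: le_trans (contr _ _ _ hy ball0) _.
      by rewrite mulrC ler_wpM2r ?invr_ge0.
    apply: le_trans (norm_mulmx_le _ Kc) _.
    apply: le_trans (ler_wpM2l L0 (ltW zr)) _.
    have -> : L * rho = (r / 2) * (L / (1 + L)) by rewrite /rho invfM; ring.
    by rewrite ler_piMr ?frac_le// divr_ge0// ltW.
  have ctr : is_contraction (mkfun TBB : {fun B >-> B}).
    exists (2^-1)%:nng; split => /=; first by rewrite invf_lt1// ltr1n.
    move=> [y y'] [/= /BE hy /BE hy'].
    by rewrite /self_sub /= TB//; exact: contr.
  have [|y /BE By fy] := banach_fixed_point ctr (@closed_ball_closed _ _ _ _).
    by exists y0; apply/BE.
  exists y => _; split=> //.
  move: fy; rewrite /= /T => /eqP; rewrite -subr_eq0 opprB addrC subrK.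
  move=> /eqP /(congr1 (mulmx^~ J)); rewrite -mulmxA mulVmx// mulmx1 mul0mx.
  by move/eqP; rewrite subr_eq0 => /eqP.
have [chi Hchi] := choice ex.
pose U := ball z0 rho.
have UE z : U z <-> `|z - z0| < rho by rewrite /U -ball_normE /= distrC.
have chiB z : U z -> `|chi z - y0| <= r by move/UE/Hchi => [].
have chiK z : U z -> emap (chi z) = z by move/UE/Hchi => [].
have slopeE z z' : U z -> U z' ->
   (chi z' - chi z) *m eslope (chi z') (chi z) = z' - z.
  move=> Uz Uz'; rewrite -emap_sub ?chiK//.
    by have [] := Hr (chi z') y0 (chiB _ Uz') ball0.
  by have [] := Hr (chi z) y0 (chiB _ Uz) ball0.
have chi_lip z z' : U z -> U z' -> `|chi z' - chi z| <= 2 * L * `|z' - z|.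
  move=> Uz Uz'.
  have E : chi z' - chi z = (z' - z) *m K
      + (chi z' - chi z) *m (J - eslope (chi z') (chi z)) *m K.
    rewrite -mulmxDl mulmxBr slopeE// subrKC -mulmxA mulmxV//.
    by rewrite mulmx1.
  have H1 : `|chi z' - chi z| <= L * `|z' - z| + 2^-1 * `|chi z' - chi z|.
    rewrite {1}E; apply: le_trans (ler_normD _ _) _; apply: lerD.
      exact: norm_mulmx_le.
    by apply: contr; exact: chiB.
  by lra.
have chi_cont z : U z -> {for z, continuous chi}.
  move=> Uz; apply: (@cvgrPdist_le R 'rV[R]_N 'rV[R]_N (nbhs z) (nbhs_filter z) chi (chi z)).2 => e e0.
  have nU : nbhs z U by apply: open_nbhs_nbhs; split=> //; exact: ball_open.
  have d0 : 0 < e / (1 + 2 * L) by rewrite divr_gt0// ltr_pwDl// mulr_ge0.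
  have nd : \forall z' \near z, `|z - z'| <= e / (1 + 2 * L).
    by apply: filterS (nbhsx_ballx z _ d0) => z'; rewrite -ball_normE => /ltW.
  near=> z'; have Uz' : U z' by near: z'.
  have h : `|z - z'| <= e / (1 + 2 * L) by near: z'.
  apply: le_trans (chi_lip _ _ Uz' Uz) _.
  apply: le_trans (ler_wpM2l _ h) _; first by rewrite mulr_ge0.
  rewrite mulrCA; apply: ler_piMr (ltW e0) _.
  by apply: frac_le; rewrite mulr_ge0.
exists U, chi; split; first exact: (ball_open z0 rho).
  exact: (ballxx z0 rho0).
move=> z Uz.
have [h1 h2 h3 h4] := Hr _ _ (chiB _ Uz) (chiB _ Uz).
have uz : ejac (chi z) \in unitmx by rewrite -eslope_diag.
split=> //; [exact: chiK | exact: chi_cont |].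
move=> i j.
pose g (h : R) := h *: delta_mx 0 i + z : 'rV[R]_N.
have gz : g @ (0:R)^' --> z.
  have : (fun h : R => g h) @ (0:R) --> g 0.
    apply: cvgD; last exact: cvg_cst.
    by apply: cvgZr_tmp; exact: cvg_id.
  rewrite /g scale0r add0r; apply: cvg_trans; apply: cvg_app; exact: cvg_within.
have cg : (chi \o g) @ (0:R)^' --> chi z by apply: cvg_comp gz (chi_cont z Uz).
have nU : \forall h \near (0:R)^', U (g h).
  exact: (gz U (open_nbhs_nbhs (conj (ball_open z0 rho) Uz))).
have cQz a b : (fun h => eslope (chi (g h)) (chi z) a b : R^o) @ (0 : R)^'
    --> (ejac (chi z) a b : R^o).
  by apply: (cvg_eslope h2 cg); exact: cvg_cst.
have [nuz cIz] := cvg_invmx uz cQz.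
(* the difference quotient of chi along the i-th axis is an entry of S^-1 *)
suff C : (fun h : R => h^-1 *: ((((fun z => chi z 0 j) : _ -> R^o) \o shift z)
    (h *: delta_mx 0 i) - chi z 0 j)) @ (0:R)^' --> (invmx (ejac (chi z)) i j : R^o).
  split; first by apply/cvg_ex; eexists; exact: C.
  exact: (cvg_lim _ C).
refine (cvg_trans _ (cIz i j)); apply: near_eq_cvg.
have n0 : \forall h \near (0:R)^', h != 0 by exact: nbhs_dnbhs_neq.
near=> h.
have hh : h != 0 by near: h.
have Uh : U (g h) by near: h.
have uh : eslope (chi (g h)) (chi z) \in unitmx by near: h.
have := slopeE _ _ Uz Uh.
move=> /(congr1 (mulmx^~ (invmx (eslope (chi (g h)) (chi z))))).
rewrite -mulmxA mulmxV// mulmx1 /g addrK -/(g h) -scalemxAl.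
rewrite -rowE => /rowP/(_ j); rewrite !mxE /= => E.
by rewrite -/(g h) E /GRing.scale/= mulKf.
Unshelve. all: by end_near. Qed.

End LocalInverse.

(** * Smoothness of the local inverse *)

Section SmoothOfInverse.
Variables (R : realType) (n : nat) (Psi : 'I_n.+2 -> expr R 'I_n.+2).
Variables (U : set 'rV[R]_n.+2) (chi : 'rV[R]_n.+2 -> 'rV[R]_n.+2).
Hypothesis Uopen : open U.
Hypothesis chi_reg : forall z, U z -> regular_pt Psi (chi z).
Hypothesis chi_cont : forall z, U z -> {for z, continuous chi}.
Hypothesis chi_der : forall z, U z -> forall i j,
  is_derive z (delta_mx 0 i) ((fun z => chi z 0 j) : _ -> R^o)
    (invmx (ejac Psi (chi z)) i j).

Let nU z : U z -> nbhs z U.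
Proof. by move=> Uz; apply: open_nbhs_nbhs. Qed.

(** The derivative of [e] composed with the local inverse, along the i-th axis:
    the chain rule, with the derivatives of the inverse written by Cramer's
    rule. *)
Definition edirect (i : 'I_n.+2) (e : expr R 'I_n.+2) : expr R 'I_n.+2 :=
  esum (enum 'I_n.+2) (fun j =>
    EMul (der j e) (bind (einv R i j) (fun w => der w.1 (Psi w.2)))).

Lemma partial_chi (F : Jet R n -> R) (e : expr R 'I_n.+2) :
  (forall z, U z -> wd e (rv (chi z))) ->
  (forall z, U z -> F z = eval e (rv (chi z))) ->
  forall z, U z -> forall i,
  is_derive (z : 'rV[R]_n.+2) (delta_mx 0 i) (F : 'rV[R]_n.+2 -> R^o)
    (eval (edirect i e) (rv (chi z))).
Proof.
move=> we Fe z Uz i.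
apply: (@near_eq_is_derive _ _ _
   ((fun z => eval e (rv (chi z))) : 'rV[R]_n.+2 -> R^o)).
  by near=> x; rewrite Fe//; near: x; exact: nU.
apply/is_derive_lineE.
have dchi v := (is_derive_lineE _ _ _ _).1 (chi_der Uz i v).
have wz : wd e (rv (chi (0 *: delta_mx 0 i + z))) by rewrite scale0r add0r; exact: we.
apply: is_derive_eq (is_derive_eval dchi wz) _.
rewrite scale0r add0r /edirect eval_esum big_enum /=; apply: eq_bigr => j _.
transitivity (eval (der j e) (rv (chi z)) *
  eval (bind (einv R i j) (fun w => der w.1 (Psi w.2))) (rv (chi z))); last by [].
congr (_ * _); rewrite eval_bind.
have [_ uz] := chi_reg Uz.
rewrite -(eval_einv i j uz); apply: eval_ext => -[a b].
by rewrite /mx_env mxE.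
Unshelve. all: by end_near. Qed.

Lemma wd_edirect i e z : U z -> wd e (rv (chi z)) -> wd (edirect i e) (rv (chi z)).
Proof.
move=> Uz we; have [wz uz] := chi_reg Uz.
apply: wd_esum => j; split; first exact: wd_der.
apply: wd_bind => [[a b]|]; first exact: wd_der.
have := wd_einv i j uz; congr wd; apply/funext => -[a b].
by rewrite /mx_env mxE.
Qed.

Lemma continuous_chi (F : Jet R n -> R) (e : expr R 'I_n.+2) :
  (forall z, U z -> wd e (rv (chi z))) ->
  (forall z, U z -> F z = eval e (rv (chi z))) ->
  forall z : 'rV[R]_n.+2, U z -> {for z, continuous (F : 'rV[R]_n.+2 -> R^o)}.
Proof.
move=> we Fe z Uz.
have C : (fun x => eval e (rv (chi x)) : R^o) @ nbhs z --> (F z : R^o).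
  rewrite (Fe _ Uz); apply: cvg_eval (we _ Uz) => v.
  by apply: cvg_coord; exact: chi_cont.
have E : \forall x \near z, eval e (rv (chi x)) = F x.
  by apply: filterS (nU Uz) => x /Fe.
refine (cvg_trans _ C).
exact: (@near_eq_cvg _ _ (nbhs z) (nbhs_filter z) _ (F : _ -> R^o) E).
Qed.

(** The functions of the form [e] composed with [chi] are continuous, and their
    partial derivatives have the same form; hence they have continuous partial
    derivatives of every order. *)
Lemma smooth_chi (F : Jet R n -> R) (e : expr R 'I_n.+2) :
  (forall z, U z -> wd e (rv (chi z))) ->
  (forall z, U z -> F z = eval e (rv (chi z))) -> smooth_on U F.
Proof.
move=> we Fe r; elim: r F e we Fe => [|r IH] F e we Fe.
  by split; first exact: continuous_chi we Fe.
split; first exact: continuous_chi we Fe.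
move=> i; split=> [z Uz|].
  by have [] := partial_chi we Fe Uz i.
apply: (IH _ (edirect i e)) => z Uz; first by apply: wd_edirect => //; exact: we.
by have [_ <-] := partial_chi we Fe Uz i.
Qed.

End SmoothOfInverse.

(** * The infinitesimal generators as matrices *)

Section ProjectiveFields.
Variable R : realType.
Implicit Types (B : 'M[R]_3) (p : Jet R 0).

Definition affine_row B (i : 'I_3) (x u : R) : R :=
  B i 0 * x + B i 1 * u + B i 2%:R.

(** The velocity at the identity of a curve of matrices with derivative [B]
    there, acting by projective transformations: the quotient rule at the
    denominator 1. *)
Definition proj_field B : vfield R := fun p =>
  let x := xcoord p in let u := ucoord 0 p in
  mkpt (affine_row B 0 x u - x * affine_row B 2%:R x u)
       (affine_row B 1 x u - u * affine_row B 2%:R x u).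

Lemma jet0_eq p (a b : R) : p = mkpt a b <-> xcoord p = a /\ ucoord 0 p = b.
Proof.
rewrite /xcoord /ucoord; have -> : inord 1 = 1 :> 'I_2.
  by apply/val_inj; rewrite /= inordK.
split=> [->|[<- <-]]; first by rewrite !mxE.
apply/rowP => i; rewrite mxE; case: ifP => [/eqP -> //|i0].
by congr (p 0 _); apply/val_inj; case: i i0 => [[|[|]]].
Qed.

Lemma xcoord_mkpt (a b : R) : xcoord (mkpt a b) = a.
Proof. by have [] := (jet0_eq (mkpt a b) a b).1 erefl. Qed.

Lemma ucoord_mkpt (a b : R) : ucoord 0 (mkpt a b) = b.
Proof. by have [] := (jet0_eq (mkpt a b) a b).1 erefl. Qed.

(** Scalar matrices act trivially on the projective plane.  This allows passing
    between trace-zero matrices, all matrices, and the matrices whose last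
    entry is zero. *)
Lemma proj_field_scalar (a : R) B : proj_field (B + a%:M) = proj_field B.
Proof.
apply/funext => p; rewrite /proj_field /affine_row !mxE/= !mulr1n !mulr0n.
by congr mkpt; ring.
Qed.

Lemma det3 B : \det B =
  B 0 0 * (B 1 1 * B 2%:R 2%:R - B 1 2%:R * B 2%:R 1)
  - B 0 1 * (B 1 0 * B 2%:R 2%:R - B 1 2%:R * B 2%:R 0)
  + B 0 2%:R * (B 1 0 * B 2%:R 1 - B 1 1 * B 2%:R 0).
Proof.
have [b E] : exists b : nat -> nat -> R, forall i j, B i j = b i j.
  by exists (fun i j => B (inord i) (inord j)) => i j; rewrite !inord_val.
rewrite (expand_det_row _ 0) !big_ord_recl big_ord0 /cofactor.
rewrite !(expand_det_row _ 0) !big_ord_recl !big_ord0 /cofactor !det_mx11 !mxE !E /=.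
rewrite /bump /=; ring.
Qed.

Lemma is_derive_quot (f g : R -> R) (df dg : R) :
  is_derive (0 : R^o) 1 (f : R^o -> R^o) df ->
  is_derive (0 : R^o) 1 (g : R^o -> R^o) dg ->
  g 0 = 1 ->
  is_derive (0 : R^o) 1 ((fun t => f t / g t) : R^o -> R^o) (df - f 0 * dg).
Proof.
move=> fd gd g1.
have g0 : g 0 != 0 by rewrite g1 oner_neq0.
have [H1 H2] := gd.
have gVd : is_derive (0 : R^o) 1 ((fun t => (g t)^-1) : R^o -> R^o) (- dg).
  split; first exact: derivableV g0 H1.
  by rewrite deriveV// H2 g1 expr1n invr1 scaleN1r.
apply: is_derive_eq (is_deriveM fd gVd) _.
by rewrite /GRing.scale/= g1 invr1; ring.
Qed.

Lemma is_derive_affine_row (c : R -> 'M[R]_3) B i (x u : R) :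
  is_derive (0 : R^o) 1 (c : R^o -> _) B ->
  is_derive (0 : R^o) 1 ((fun t => affine_row (c t) i x u) : R^o -> R^o)
    (affine_row B i x u).
Proof.
move=> /is_derive_mxP cd.
have H j (a : R) : is_derive (0 : R^o) 1 ((fun t => c t i j * a) : R^o -> R^o) (B i j * a).
  apply: is_derive_eq (is_deriveM (cd i j) (is_derive_cst a _ _)) _.
  by rewrite /GRing.scale/= mulr0 add0r mulrC.
exact: is_deriveD (is_deriveD (H 0 x) (H 1 u)) (cd i 2%:R).
Qed.

Lemma is_derive_proj_act (c : R -> 'M[R]_3) B p :
  c 0 = 1%:M -> is_derive (0 : R^o) 1 (c : R^o -> _) B ->
  is_derive (0 : R^o) 1 ((fun t => proj_act (c t) p) : R^o -> 'rV[R]_2) (proj_field B p).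
Proof.
move=> c0 cd; apply/is_derive_mxP => i j.
set x := xcoord p; set u := ucoord 0 p.
have A0 k : affine_row (c 0) k x u = affine_row 1%:M k x u by rewrite c0.
have a2 : affine_row (c 0) 2%:R x u = 1.
  by rewrite A0 /affine_row !mxE/= ?mulr1n ?mulr0n; ring.
have H k := is_derive_affine_row k x u cd.
rewrite ord1.
have -> : (fun t => proj_act (c t) p 0 j) = (fun t =>
   affine_row (c t) (if j == 0 then 0 else 1) x u / affine_row (c t) 2%:R x u).
  by apply/funext => t; rewrite /proj_act mxE; case: ifP.
apply: is_derive_eq (is_derive_quot (H _) (H _) a2) _.
rewrite A0 mxE; case: ifP => _; rewrite -/x -/u /affine_row !mxE/= ?mulr1n ?mulr0n; ring.
Qed.

(** The curve 1 + t B has determinant 1 + O(t^2) because B has trace zero.  So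
    dividing its first row by its determinant leaves the derivative at 0
    unchanged.  Away from 0, where the determinant may vanish, the
    curve is completed by the identity. *)
Lemma sl3_curve B : \tr B = 0 ->
  exists c : R -> 'M[R]_3, [/\ forall t, \det (c t) = 1, c 0 = 1%:M &
    is_derive (0 : R^o) 1 (c : R^o -> _) B].
Proof.
move=> trB; pose M (t : R) : 'M[R]_3 := 1%:M + t *: B.
pose c t := if \det (M t) == 0 then 1%:M else
   diag_mx (\row_i if i == 0 then (\det (M t))^-1 else 1) *m M t.
have [q dM] : exists q : {poly R}, forall t, \det (M t) = (1 + 'X ^+ 2 * q).[t].
  have tr3 : B 2%:R 2%:R = - B 0 0 - B 1 1.
    move: trB; rewrite /mxtrace !big_ord_recl big_ord0 addr0.
    have -> : lift ord0 (lift ord0 ord0) = 2%:R :> 'I_3 by exact/val_inj.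
    have -> : lift ord0 ord0 = 1 :> 'I_3 by exact/val_inj.
    by move=> /eqP; rewrite addrA addrC addr_eq0 => /eqP ->; rewrite opprD.
  exists ((B 0 0 * B 1 1 + (B 0 0 + B 1 1) * B 2%:R 2%:R
     - B 0 1 * B 1 0 - B 0 2%:R * B 2%:R 0 - B 1 2%:R * B 2%:R 1)%:P
     + (\det B) *: 'X).
  move=> t; rewrite !hornerE/= det3 /M !mxE/= det3 tr3 ?mulr1n ?mulr0n.
  by ring.
have M0 : M 0 = 1%:M by rewrite /M scale0r addr0.
exists c; split.
- move=> t; rewrite /c; case: eqP => [_|/eqP d0]; first by rewrite det1.
  rewrite det_mulmx det_diag !big_ord_recl big_ord0 !mxE/= !mulr1.
  by rewrite mulVf.
- by rewrite /c M0 det1 oner_eq0 mulmx1; apply/matrixP => i j; rewrite !mxE invr1 if_same.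
have dd : is_derive (0 : R^o) 1 ((fun t => \det (M t)) : R^o -> R^o) 0.
  have -> : (fun t => \det (M t)) = horner (1 + 'X ^+ 2 * q) by apply/funext.
  apply: is_derive_eq (is_derive_poly _ _) _.
  by rewrite -polyC1 derivD derivC derivM derivXn !hornerE/=; ring.
have nd : \forall t \near (0 : R^o), \det (M t) != 0.
  have dd' : derivable ((fun t => \det (M t)) : R^o -> R^o) 0 1 by have [] := dd.
  have /derivable1_diffP/differentiable_continuous := dd'.
  by move=> /cvgr_neq0; apply; rewrite M0 det1 oner_neq0.
apply/is_derive_mxP => i j.
have Md : is_derive (0 : R^o) 1 ((fun t => M t i j) : R^o -> R^o) (B i j).
  have -> : (fun t => M t i j) = (fun t => (1%:M : 'M[R]_3) i j + t * B i j).
    by apply/funext => t; rewrite /M !mxE.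
  apply: is_derive_eq (is_deriveD (is_derive_cst _ _ _)
    (is_deriveM (is_derive_id _ _) (is_derive_cst (B i j) _ _))) _.
  by rewrite /GRing.scale/= mul0r mulr1 !add0r.
apply: (@near_eq_is_derive _ _ _
   ((fun t => M t i j / (if i == 0 then \det (M t) else 1)) : R^o -> R^o)).
  apply: filterS nd => t tn; rewrite /c (negPf tn).
  rewrite mul_diag_mx [RHS]mxE [X in _ = X * _]mxE [RHS]mulrC.
  by case: ifP => _; rewrite ?invr1.
case: (i == 0).
  by apply: is_derive_eq (is_derive_quot Md dd _) _; rewrite ?mulr0 ?subr0// M0 det1.
have := is_derive_quot (g := cst 1) Md (is_derive_cst (1 : R^o) _ _) erefl.
by rewrite mulr0 subr0.
Unshelve. all: by end_near. Qed.

Lemma sl3_generatorsE (v : vfield R) :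
  @sl3_generators R v <-> exists B, v = proj_field B.
Proof.
split=> [[c [_ c0 cd vd]]|[B ->]].
  exists ('D_1 (c : R^o -> 'M[R]_3) 0); apply/funext => p.
  have dc : is_derive (0 : R^o) 1 (c : R^o -> _) ('D_1 (c : R^o -> 'M[R]_3) 0) by split.
  exact: (is_derive_uniq (vd p) (is_derive_proj_act p c0 dc)).
pose t := - (\tr B / 3).
have [|c [cdet c0 cd]] := @sl3_curve (B + t%:M).
  by rewrite mxtraceD mxtrace_scalar /t -mulr_natr; field.
rewrite -(proj_field_scalar t B).
exists c; split; [exact: cdet|exact: c0|by case: cd|move=> p].
exact: is_derive_proj_act.
Qed.

(** The coordinates of [proj_field B] on [sl3_fields]. *)
Definition sl3_coefs B : seq R :=
  [:: B 0 2%:R; B 1 2%:R; B 0 0 - B 2%:R 2%:R; B 1 1 - B 2%:R 2%:R; B 1 0;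
      B 0 1; - B 2%:R 0; - B 2%:R 1].

Lemma sl3_fields_sum (c : nat -> R) p :
  \sum_(i < size (sl3_fields R)) c i *: (nth (fun=> 0 : 'rV[R]_2) (sl3_fields R) i p : 'rV[R]_2)
  = let x := xcoord p in let u := ucoord 0 p in
  mkpt (c 0%N + c 2%N * x + c 5%N * u + c 6%N * x ^+ 2 + c 7%N * (x * u))
       (c 1%N + c 3%N * u + c 4%N * x + c 6%N * (x * u) + c 7%N * u ^+ 2).
Proof.
rewrite /= !big_ord_recl big_ord0 /=.
by apply/rowP => j; rewrite !mxE; case: ifP => _ /=; ring.
Qed.

Lemma spanned_sl3E (v : vfield R) :
  spanned_by_fields (sl3_fields R) v <-> exists B, v = proj_field B.
Proof.
split=> [[c Hc]|[B ->]].
  pose d k := c (inord k).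
  pose rows := [:: [:: d 2%N; d 5%N; d 0%N]; [:: d 4%N; d 3%N; d 1%N];
                [:: - d 6%N; - d 7%N; 0]].
  exists (\matrix_(i, j) nth 0 (nth [::] rows i) j).
  apply/funext => p; rewrite Hc.
  have -> : \sum_(i < size (sl3_fields R)) c i *: (nth (fun=> 0 : 'rV[R]_2) (sl3_fields R) i p : 'rV[R]_2)
   = \sum_(i < size (sl3_fields R)) d i *: (nth (fun=> 0 : 'rV[R]_2) (sl3_fields R) i p : 'rV[R]_2).
    by apply: eq_bigr => i _; rewrite /d inord_val.
  rewrite (sl3_fields_sum d) /proj_field /affine_row !mxE /=.
  by congr mkpt; ring.
exists (fun i => nth 0 (sl3_coefs B) i) => p.
rewrite (sl3_fields_sum (fun i => nth 0 (sl3_coefs B) i)) /proj_field /affine_row /=.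
by congr mkpt; ring.
Qed.

(** The matrix units other than the last one.  They represent a basis of the
    generators, by [proj_field_scalar]. *)
Definition lie_basis (l : 'I_8) : 'M[R]_3 := delta_mx (inord (l %/ 3)) (inord (l %% 3)).

Definition lie_mx (c : 'rV[R]_8) : 'M[R]_3 := \sum_l c 0 l *: lie_basis l.

Lemma lie_mxE c i j : lie_mx c i j = if (3 * i + j < 8)%N then c 0 (inord (3 * i + j)) else 0.
Proof.
rewrite /lie_mx summxE; have lti := ltn_ord i; have ltj := ltn_ord j.
have E (l : 'I_8) : ((inord (l %/ 3) == i) && (inord (l %% 3) == j)) = (l == 3 * i + j :> nat)%N.
  have ltl := ltn_ord l; rewrite -!val_eqE /= !inordK ?ltn_mod//; last by lia.
  by apply/andP/eqP => [[/eqP h1 /eqP h2]|h]; [lia|split; apply/eqP; lia].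
case: ifP => h.
  rewrite (bigD1 (inord (3 * i + j)))//= !mxE ![i == _]eq_sym ![j == _]eq_sym E.
  rewrite inordK// eqxx mulr1 big1 ?addr0// => l; rewrite -val_eqE/= inordK// => /negPf nl.
  by rewrite !mxE ![i == _]eq_sym ![j == _]eq_sym E nl mulr0.
rewrite big1// => l _; rewrite !mxE ![i == _]eq_sym ![j == _]eq_sym E.
case: eqP => h'; last by rewrite mulr0.
by have := ltn_ord l; rewrite h' h.
Qed.

Lemma proj_field_lie_mx B : exists c, proj_field B = proj_field (lie_mx c).
Proof.
pose B' := B + (- B 2%:R 2%:R)%:M.
exists (\row_l B' (inord (l %/ 3)) (inord (l %% 3))).
rewrite -(proj_field_scalar (- B 2%:R 2%:R)) -/B'; congr proj_field.
apply/matrixP => i j; rewrite lie_mxE; have lti := ltn_ord i; have ltj := ltn_ord j.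
case: ifP => h.
  rewrite [RHS]mxE inordK//; congr (B' _ _); apply/val_inj; rewrite /= inordK ?ltn_mod//; lia.
have -> : i = 2%:R by apply/val_inj => /=; lia.
have -> : j = 2%:R by apply/val_inj => /=; lia.
by rewrite !mxE eqxx mulr1n subrr.
Qed.

End ProjectiveFields.

(** * Prolongation along jets of curves *)

Section Jets.
Variable R : realType.

Definition mkjet n (x : R) (u : nat -> R) : Jet R n :=
  \row_(i < n.+2) if (i : nat) is j.+1 then u j else x.

Lemma mkjetE n x u (i : 'I_n.+2) :
  mkjet n x u 0 i = if (i : nat) is j.+1 then u j else x.
Proof. by rewrite mxE. Qed.

Lemma xcoord_mkjet n x u : xcoord (mkjet n x u) = x.
Proof. by rewrite /xcoord mxE. Qed.

Lemma ucoord_mkjet n k x u : (k <= n)%N -> ucoord k (mkjet n x u) = u k.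
Proof. by move=> kn; rewrite /ucoord mxE inordK. Qed.

Lemma mkjet_coords n (z : Jet R n) : mkjet n (xcoord z) (fun k => ucoord k z) = z.
Proof.
apply/rowP => i; rewrite mxE /xcoord /ucoord.
case: i => [[|i] lti] /=; first by congr (z 0 _); exact/val_inj.
by congr (z 0 _); apply/val_inj; rewrite /= inordK.
Qed.

Lemma jcast_mkjet n m x u : (m <= n)%N -> jcast m (mkjet n x u) = mkjet m x u.
Proof.
move=> mn; apply/rowP => i; rewrite !mxE; have lti := ltn_ord i.
have h : (i < n.+2)%N by apply: leq_trans lti _.
by rewrite h inordK.
Qed.

Lemma jcast_trunc n m k (z : Jet R n) : (k <= m)%N -> (k <= n)%N ->
  jcast k (jcast m z) = jcast k z.
Proof.
move=> km kn; apply/rowP => i; rewrite !mxE; have lti := ltn_ord i.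
have h1 : (i < m.+2)%N by apply: leq_trans lti _.
have h2 : (i < n.+2)%N by apply: leq_trans lti _.
by rewrite h1 h2 inordK// h2.
Qed.

Lemma jcast_id n (z : Jet R n) : jcast n z = z.
Proof. by rewrite -(mkjet_coords z) jcast_mkjet. Qed.

(** The coefficients of the prolonged generators are polynomials in the jet
    coordinates; [e] is such a polynomial. *)
Definition represents n (e : expr R 'I_n.+2) (F : Jet R n -> R) : Prop :=
  forall z : Jet R n, wd e (rv z) /\ F z = eval e (rv z).

Lemma is_derive_represented n e (F : Jet R n -> R) (z : 'rV[R]_n.+2) i :
  represents e F ->
  is_derive z (delta_mx 0 i) (F : 'rV[R]_n.+2 -> R^o) (eval (der i e) (rv z)).
Proof.
move=> eF; have -> : F = fun z => eval e (rv z) by apply/funext => y; case: (eF y).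
apply/is_derive_lineE.
have dc v : is_derive (0 : R^o) 1 ((fun h => rv (h *: delta_mx 0 i + z) v) : R^o -> R^o)
    (v == i)%:R.
  have -> : (fun h : R => rv (h *: delta_mx 0 i + z) v) = (fun h => h * (v == i)%:R + z 0 v).
    by apply/funext => h; rewrite /rv !mxE.
  apply: is_derive_eq (is_deriveD (is_deriveM (is_derive_id _ _)
    (is_derive_cst (_ : R^o) _ _)) (is_derive_cst (_ : R^o) _ _)) _.
  by rewrite /GRing.scale/= mulr1 mul0r add0r addr0.
have wz : wd e (rv (0 *: delta_mx 0 i + z)) by case: (eF (0 *: delta_mx 0 i + z)).
apply: is_derive_eq (is_derive_eval dc wz) _.
rewrite scale0r add0r (bigD1 i)//= eqxx mulr1 big1 ?addr0//.
by move=> w /negPf ->; rewrite mulr0.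
Qed.

Lemma partial_represented n e (F : Jet R n -> R) i z :
  represents e F -> partial i F z = eval (der i e) (rv z).
Proof. by move=> /(is_derive_represented z i) [_ <-]. Qed.

(** Composition with [jcast m], from n-jets to m-jets. *)
Definition pull n m (e : expr R 'I_m.+2) : expr R 'I_n.+2 :=
  bind e (fun i => if (i < n.+2)%N then EVar R (inord i) else ECst _ 0).

Lemma eval_pull n m (e : expr R 'I_m.+2) (z : Jet R n) :
  eval (pull n e) (rv z) = eval e (rv (jcast m z)).
Proof.
rewrite eval_bind; apply: eval_ext => i; rewrite /rv [RHS]mxE.
by case: ifP.
Qed.

Lemma wd_pull n m (e : expr R 'I_m.+2) (z : Jet R n) :
  wd e (rv (jcast m z)) -> wd (pull n e) (rv z).
Proof.
move=> w; apply: wd_bind => [i|]; first by case: ifP.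
suff -> : (fun i : 'I_m.+2 => eval (if (i < n.+2)%N then EVar R (inord i) else ECst _ 0) (rv z))
  = rv (jcast m z) by [].
by apply/funext => i; rewrite /rv mxE; case: ifP.
Qed.

Definition eDtot m (e : expr R 'I_m.+2) : expr R 'I_m.+3 :=
  EAdd (pull m.+1 (der ord0 e))
    (esum (enum 'I_m.+1)
      (fun k => EMul (EVar R (inord k.+2)) (pull m.+1 (der (lift ord0 k) e)))).

Lemma represents_Dtot m e (F : Jet R m -> R) :
  represents e F -> represents (eDtot e) (Dtot F).
Proof.
move=> eF z; have [w _] := eF (jcast m z); split.
  split; first by apply: wd_pull; exact: wd_der.
  by apply: wd_esum => k; split=> //; apply: wd_pull; exact: wd_der.
rewrite /Dtot (partial_represented _ _ eF) /= eval_pull; congr (_ + _).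
rewrite eval_esum big_enum/=; apply: eq_bigr => k _.
by rewrite (partial_represented _ _ eF) /= eval_pull.
Qed.

Lemma Dtot_linear m e1 e2 (F1 F2 : Jet R m -> R) (a : R) z :
  represents e1 F1 -> represents e2 F2 ->
  Dtot (fun z => a * F1 z + F2 z) z = a * Dtot F1 z + Dtot F2 z.
Proof.
move=> r1 r2.
have r12 : represents (EAdd (EMul (ECst _ a) e1) e2) (fun z => a * F1 z + F2 z).
  by move=> y; have [w1 E1] := r1 y; have [w2 E2] := r2 y; rewrite E1 E2.
have L i y : partial i (fun z => a * F1 z + F2 z) y
     = a * partial i F1 y + partial i F2 y.
  rewrite (partial_represented _ _ r12) (partial_represented _ _ r1).
  by rewrite (partial_represented _ _ r2) /=; ring.
rewrite /Dtot L; under eq_bigr do rewrite L mulrDr mulrCA.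
by rewrite big_split/= -mulr_sumr; ring.
Qed.

Lemma xi_proj_field B n (z : Jet R n) :
  xi (proj_field B) z = affine_row B 0 (xcoord z) (ucoord 0 z)
    - xcoord z * affine_row B 2%:R (xcoord z) (ucoord 0 z).
Proof. by rewrite -(mkjet_coords z) /xi /proj_field xcoord_mkpt jcast_mkjet// !xcoord_mkjet !ucoord_mkjet. Qed.

Lemma characteristic_proj_field B (z : Jet R 1) :
  characteristic (proj_field B) z = affine_row B 1 (xcoord z) (ucoord 0 z)
   - ucoord 0 z * affine_row B 2%:R (xcoord z) (ucoord 0 z) - xi (proj_field B) z * ucoord 1 z.
Proof.
rewrite /characteristic; congr (_ - _).
by rewrite -(mkjet_coords z) /proj_field ucoord_mkpt jcast_mkjet// !xcoord_mkjet !ucoord_mkjet.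
Qed.

Lemma represents_DQ B k : exists e, represents e (@DQ R (proj_field B) k).
Proof.
elim: k => [|k [e /represents_Dtot er]]; last by exists (eDtot e).
pose X := EVar R (0 : 'I_3); pose U := EVar R (inord 1 : 'I_3).
pose U1 := EVar R (inord 2 : 'I_3).
pose aff i := EAdd (EAdd (EMul (ECst 'I_3 (B i 0)) X) (EMul (ECst 'I_3 (B i 1)) U))
  (ECst 'I_3 (B i 2%:R)).
pose sub (a b : expr R 'I_3) := EAdd a (EMul (ECst _ (-1)) b).
exists (sub (sub (aff 1) (EMul U (aff 2%:R)))
            (EMul (sub (aff 0) (EMul X (aff 2%:R))) U1)).
move=> z; split; first by rewrite /=; tauto.
rewrite [DQ _ _]/= characteristic_proj_field xi_proj_field /affine_row /xcoord /ucoord /rv /=.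
ring.
Qed.

Lemma DQ_linear B1 B2 (a : R) k z :
  @DQ R (proj_field (a *: B1 + B2)) k z = a * DQ (proj_field B1) z + DQ (proj_field B2) z.
Proof.
elim: k z => [|k IH] z.
  rewrite /= !characteristic_proj_field !xi_proj_field /affine_row !mxE; ring.
have -> : DQ (proj_field (a *: B1 + B2)) (k := k.+1) z =
   Dtot (fun z => a * DQ (proj_field B1) z + DQ (proj_field B2) z) z.
  by rewrite /=; congr (Dtot _ z); apply/funext => y; rewrite IH.
have [e1 r1] := represents_DQ B1 k; have [e2 r2] := represents_DQ B2 k.
exact: Dtot_linear r1 r2.
Qed.

Lemma xi_linear B1 B2 (a : R) n (z : Jet R n) :
  xi (proj_field (a *: B1 + B2)) z = a * xi (proj_field B1) z + xi (proj_field B2) z.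
Proof. by rewrite !xi_proj_field /affine_row !mxE; ring. Qed.

Lemma prolong_linear B1 B2 (a : R) n (z : Jet R n) :
  prolong (proj_field (a *: B1 + B2)) z = a *: prolong (proj_field B1) z + prolong (proj_field B2) z.
Proof.
apply/rowP => i; rewrite !mxE; case: unliftP => [j _|_]; last exact: xi_linear.
by rewrite /phi DQ_linear xi_linear; ring.
Qed.

(** Its rows span the tangent space of the orbit through [z]. *)
Definition generator_mx n (z : Jet R n) : 'M[R]_(8, n.+2) :=
  \matrix_(l < 8) prolong (proj_field (lie_basis R l)) z.

Lemma prolong_lie_mx n (z : Jet R n) c :
  prolong (proj_field (lie_mx c)) z = c *m generator_mx z.
Proof.
rewrite /lie_mx mulmx_sum_row.
under [RHS]eq_bigr do rewrite rowK.
have p0 : prolong (proj_field 0) z = 0.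
  have := prolong_linear 0 0 1 z; rewrite scaler0 addr0 scale1r.
  by move/eqP; rewrite -subr_eq0 opprD addrA subrr sub0r oppr_eq0 => /eqP.
elim: (index_enum _) => [|l s IH]; first by rewrite !big_nil.
by rewrite !big_cons prolong_linear IH.
Qed.

(** The value of phi^k depends only on the k-jet.  By induction, D_x^k Q is
    affine in its top coordinate u_(k+1) with slope -xi; hence this slope is
    also the coefficient of u_(k+2) in D_x^(k+1) Q, which cancels against
    xi u_(k+2). *)
Lemma phi_top (v : vfield R) k (z z' : Jet R k.+1) :
  jcast k z = jcast k z' -> phi v z = phi v z'.
Proof.
elim: k z z' => [|k IH] z z' zz'.
  have E (y : Jet R 1) : phi v y = ucoord 0 (v (jcast 0 y)).
    by rewrite /phi /= /characteristic subrK.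
  by rewrite !E zz'.
have X (n : nat) (y : Jet R n.+1) : xi v (jcast n y) = xi v y.
  by rewrite /xi jcast_trunc.
have slope (y : Jet R k.+1) : partial (lift ord0 ord_max) (@DQ R v k) y = - xi v y.
  pose d : 'rV[R]_k.+3 := delta_mx 0 (lift ord0 ord_max).
  have E h : @DQ R v k (h *: d + y) = @DQ R v k y - xi v y * h.
    have J : jcast k (h *: d + y) = jcast k y.
      apply/rowP => i; rewrite !mxE; case: ifP => // lti.
      rewrite /= [_ == lift _ _]negbTE ?mulr0 ?add0r//.
      by rewrite -val_eqE /= inordK// /bump /= add1n neq_ltn ltn_ord.
    have := IH _ _ J; rewrite /phi -X J X => /eqP.
    rewrite eq_sym -subr_eq => /eqP <-.
    rewrite /ucoord !mxE /=.
    have -> : inord k.+2 = lift ord0 ord_max :> 'I_k.+3.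
      by apply/val_inj; rewrite /= inordK.
    by rewrite eqxx mulr1; ring.
  suff H : is_derive (y : 'rV[R]_k.+3) d (@DQ R v k : _ -> R^o) (- xi v y).
    by have [_ <-] := H.
  apply/is_derive_lineE.
  have -> : (fun h => DQ v (h *: d + y)) = (fun h => @DQ R v k y - xi v y * h).
    by apply/funext => h; exact: E.
  apply: is_derive_eq (is_deriveB (is_derive_cst (_ : R^o) _ _)
    (is_deriveM (is_derive_cst (_ : R^o) _ _) (is_derive_id _ _))) _.
  by rewrite /GRing.scale/= mulr1 mulr0 addr0 sub0r.
have U j (y y' : Jet R k.+2) : jcast k.+1 y = jcast k.+1 y' -> (j <= k.+1)%N ->
    ucoord j y = ucoord j y'.
  move=> yy' jk; move: yy'.
  rewrite -(mkjet_coords y) -(mkjet_coords y') !jcast_mkjet// => /rowP/(_ (inord j.+1)).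
  by rewrite !mxE inordK// !ucoord_mkjet// ltnW.
have xz : xi v z = xi v z' by rewrite -[LHS]X zz' X.
rewrite /phi /= /Dtot zz' -!addrA; congr (_ + _).
rewrite [in LHS]big_ord_recr [in RHS]big_ord_recr /= !slope !X xz.
rewrite -!addrA; congr (_ + _); last by ring.
apply: eq_bigr => j _; congr (_ * _).
by apply: U => //=; rewrite ltnS ltnW.
Qed.

(** The total derivative is the derivative along jets of curves: on a curve
    t |-> (x, u_(0), u_(1), ...) with du_(j) = u_(j+1) dx, differentiating
    D_x^k Q gives D_x^(k+1) Q times dx. *)
Lemma is_derive_DQ_curve B k (x : R -> R) (u : nat -> R -> R) (t xd : R) :
  is_derive (t : R^o) 1 (x : R^o -> R^o) xd ->
  (forall j, is_derive (t : R^o) 1 (u j : R^o -> R^o) (u j.+1 t * xd)) ->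
  is_derive (t : R^o) 1
   ((fun h => DQ (proj_field B) (mkjet k.+1 (x h) (u^~ h))) : R^o -> R^o)
   (xd * DQ (proj_field B) (mkjet k.+2 (x t) (u^~ t))).
Proof.
move=> dx du; have [e re] := represents_DQ B k.
have -> : (fun h => DQ (proj_field B) (mkjet k.+1 (x h) (u^~ h))) =
   (fun h => eval e (rv (mkjet k.+1 (x h) (u^~ h)))).
  by apply/funext => h; have [_ ->] := re (mkjet k.+1 (x h) (u^~ h)).
have [w _] := re (mkjet k.+1 (x t) (u^~ t)).
pose d (v : 'I_k.+3) := if (v : nat) is j.+1 then u j.+1 t * xd else xd.
have dc v : is_derive (t : R^o) 1
    ((fun h => rv (mkjet k.+1 (x h) (u^~ h)) v) : R^o -> R^o) (d v).
  rewrite /d /rv; under eq_fun do rewrite mkjetE.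
  by case: (nat_of_ord v).
apply: is_derive_eq (is_derive_eval dc w) _.
rewrite big_ord_recl /= /Dtot jcast_mkjet// mulrDr (partial_represented _ _ re).
congr (_ + _); first by rewrite mulrC.
rewrite mulr_sumr; apply: eq_bigr => j _.
rewrite (partial_represented _ _ re) ucoord_mkjet ?ltn_ord// /d /=.
by ring.
Qed.

End Jets.

(** * Orbit dimensions *)

Section OrbitDimension.
Variable R : realType.
Let g := @sl3_generators R.

Lemma generatorP (v : vfield R) : g v <-> exists c, v = proj_field (lie_mx c).
Proof.
split=> [/sl3_generatorsE[B ->]|[c ->]]; first by have [c ->] := proj_field_lie_mx B; exists c.
by apply/sl3_generatorsE; exists (lie_mx c).
Qed.

Definition orbit_map n (z : Jet R n) : 'Hom('rV[R]_8, 'rV[R]_n.+2) :=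
  linfun (mulmxr (generator_mx z)).

Definition orbit_space n (z : Jet R n) : {vspace 'rV[R]_n.+2} := limg (orbit_map z).

Lemma orbit_spaceP n (z : Jet R n) (w : 'rV[R]_n.+2) :
  reflect (exists c, w = c *m generator_mx z) (w \in orbit_space z).
Proof.
apply: (iffP memv_imgP) => [[c _ ->]|[c ->]]; first by exists c; rewrite lfunE.
by exists c; rewrite ?memvf// lfunE.
Qed.

Lemma orbit_dimE n (z : Jet R n) d :
  orbit_dim g z d <-> \dim (orbit_space z) = d.
Proof.
split=> [[X [Xg gX <-]]|<-].
  congr (\dim _); apply/eqP; rewrite eqEsubv; apply/andP; split.
    apply/subvP => w /orbit_spaceP[c ->].
    by rewrite -prolong_lie_mx; apply: gX; apply/generatorP; exists c.
  apply/span_subvP => w /Xg[v /generatorP[c ->] ->].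
  by apply/orbit_spaceP; exists c; rewrite prolong_lie_mx.
pose X := [seq row l (generator_mx z) | l <- enum 'I_8].
have XV : <<X>>%VS = orbit_space z.
  apply/eqP; rewrite eqEsubv; apply/andP; split.
    apply/span_subvP => w /mapP[l _ ->].
    by apply/orbit_spaceP; exists (delta_mx 0 l); rewrite -rowE.
  apply/subvP => w /orbit_spaceP[c ->]; rewrite mulmx_sum_row.
  apply: memv_suml => l _; apply: memvZ; apply: memv_span.
  by apply: map_f; rewrite mem_enum.
exists X; split=> [w /mapP[l _ ->]|v /generatorP[c ->]|].
- exists (proj_field (lie_mx (delta_mx 0 l))); first by apply/generatorP; eexists.
  by rewrite prolong_lie_mx -rowE.
- by rewrite XV; apply/orbit_spaceP; exists c; rewrite prolong_lie_mx.
- by rewrite XV.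
Qed.

Lemma dim_row m : \dim {: 'rV[R]_m} = m.
Proof. by rewrite dimvf /dim /= mul1n. Qed.

Lemma orbit_space_le n (z : Jet R n) : (\dim (orbit_space z) <= minn 8 n.+2)%N.
Proof.
rewrite leq_min; apply/andP; split; last first.
  by rewrite -[leqRHS](dim_row n.+2); exact: dimvS (subvf _).
have := limg_ker_dim (orbit_map z) fullv.
by rewrite dim_row => <-; rewrite leq_addl.
Qed.

Lemma orbit_dim8P n (z : Jet R n) :
  (\dim (orbit_space z) = 8)%N <-> row_free (generator_mx z).
Proof.
have := limg_ker_dim (orbit_map z) fullv.
rewrite dim_row capfv -/(orbit_space z) => D; split=> [d8|rf].
  move/eqP: D; rewrite d8 -[X in _ == X]add0n eqn_add2r dimv_eq0 => /eqP L0.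
  apply: inj_row_free => c cM.
  have : c \in lker (orbit_map z).
    by rewrite memv_ker lfunE /= cM.
  by rewrite L0 memv0 => /eqP.
suff L0 : lker (orbit_map z) = 0%VS.
  by move: D; rewrite L0 dimv0.
apply/eqP; rewrite -subv0; apply/subvP => c; rewrite memv_ker lfunE /= memv0.
move=> /eqP cM; apply/eqP; apply: (row_free_inj rf).
by rewrite mul0mx.
Qed.

Lemma is_derive_horner_derivn (f : {poly R}) j t :
  is_derive (t : R^o) 1 ((fun h => f^`(j).[h]) : R^o -> R^o) (f^`(j.+1).[t] * 1).
Proof. by rewrite mulr1 derivnS; exact: is_derive_poly. Qed.

Definition affine_poly (B : 'M[R]_3) (f : {poly R}) i : {poly R} :=
  (B i 0)%:P * 'X + (B i 1)%:P * f + (B i 2%:R)%:P.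

Definition characteristic_poly (B : 'M[R]_3) (f : {poly R}) : {poly R} :=
  affine_poly B f 1 - f * affine_poly B f 2%:R
  - (affine_poly B f 0 - 'X * affine_poly B f 2%:R) * f^`().

(** On the graph of a polynomial f, the characteristic is a polynomial in x, and
    D_x^k Q is its k-th derivative. *)
Lemma DQ_poly B (f : {poly R}) k t :
  DQ (proj_field B) (mkjet k.+1 t (fun j => f^`(j).[t])) = (characteristic_poly B f)^`(k).[t].
Proof.
elim: k t => [|k IH] t.
  rewrite [LHS]/= characteristic_proj_field xi_proj_field xcoord_mkjet !ucoord_mkjet//.
  by rewrite derivn0 derivn1 derivn0 /characteristic_poly /affine_poly /affine_row !hornerE.
have D1 := is_derive_DQ_curve B k (is_derive_id (t : R^o) 1)
   (fun j => is_derive_horner_derivn f j t).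
have D2 : is_derive (t : R^o) 1
  ((fun h => DQ (proj_field B) (mkjet k.+1 h (fun j => f^`(j).[h]))) : R^o -> R^o)
  (characteristic_poly B f)^`(k.+1).[t].
  have -> : (fun h => DQ (proj_field B) (mkjet k.+1 h (fun j => f^`(j).[h])))
     = horner (characteristic_poly B f)^`(k) by apply/funext.
  by rewrite derivnS; exact: is_derive_poly.
by rewrite -(is_derive_uniq D1 D2) mul1r.
Qed.

Definition witness_poly : {poly R} := 'X^2 + 'X^5.

(** The n-jet at the origin of u = x^2 + x^5.  The origin is neither an
    inflection point nor a sextactic point of this curve, which is what
    genericity requires. *)
Definition witness n : Jet R n := mkjet n 0 (fun j => witness_poly^`(j).[0]).

Lemma prolong0 n v (z : Jet R n) : prolong v z 0 0 = xi v z.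
Proof. by rewrite mxE unlift_none. Qed.

Lemma prolongS n v (z : Jet R n) (k : 'I_n.+1) :
  prolong v z 0 (lift ord0 k) = phi v (jcast k.+1 z).
Proof. by rewrite mxE liftK. Qed.

Lemma prolong_witness n B k : (k <= n)%N -> xi (proj_field B) (witness n) = 0 ->
  prolong (proj_field B) (witness n) = 0 -> (characteristic_poly B witness_poly)`_k = 0.
Proof.
move=> kn xi0 p0; have kn' : (k < n.+1)%N by [].
have := prolongS (proj_field B) (witness n) (Ordinal kn'); rewrite p0 mxE /=.
have -> : phi (proj_field B) (jcast k.+1 (witness n)) = phi (proj_field B) (witness k.+1).
  by apply: phi_top; rewrite jcast_trunc// /witness !jcast_mkjet.
rewrite /phi DQ_poly.
have -> : xi (proj_field B) (witness k.+1) = 0.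
  by rewrite -xi0 !xi_proj_field !xcoord_mkjet !ucoord_mkjet.
rewrite mul0r addr0 horner_coef0 coef_derivn addn0 ffactnn => /esym/eqP.
by rewrite mulrn_eq0 => /orP[|/eqP //]; rewrite eqn0Ngt fact_gt0.
Qed.

(** A generator that vanishes at the 6-jet of the witness has a characteristic
    whose Taylor coefficients of orders 0 to 6 vanish.  These are seven linear
    equations in the entries of the matrix; with xi = 0 at the origin, they
    force the matrix to be zero. *)
Lemma witness_free n (c : 'rV[R]_8) : (6 <= n)%N -> c *m generator_mx (witness n) = 0 -> c = 0.
Proof.
move=> n6; rewrite -prolong_lie_mx; set B := lie_mx c; move=> p0.
have xi0 : xi (proj_field B) (witness n) = 0 by rewrite -prolong0 p0 mxE.
have q0 k : (k <= 6)%N -> (characteristic_poly B witness_poly)`_k = 0.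
  by move=> k6; apply: prolong_witness (leq_trans k6 n6) xi0 p0.
have b22 : B 2%:R 2%:R = 0 by rewrite lie_mxE.
have b02 : B 0 2%:R = 0.
  move: xi0; rewrite xi_proj_field xcoord_mkjet ucoord_mkjet// derivn0 /witness_poly.
  rewrite !hornerE /affine_row /= => <-; ring.
(* the expansion of phi - xi f' for f = x^2 + x^5 *)
have qE : characteristic_poly B witness_poly =
  (B 1 2%:R)%:P + (B 1 0)%:P * 'X + (B 1 1 - 2 * B 0 0)%:P * 'X^2
  + (B 2%:R 0 - 2 * B 0 1)%:P * 'X^3 + (B 2%:R 1)%:P * 'X^4
  + (B 1 1 - 5 * B 0 0)%:P * 'X^5 + (4 * B 2%:R 0 - 7 * B 0 1)%:P * 'X^6
  + (5 * B 2%:R 1)%:P * 'X^7 + (4 * B 2%:R 1)%:P * 'X^10 - (5 * B 0 1)%:P * 'X^9.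
  rewrite /characteristic_poly /affine_poly /witness_poly b02 b22.
  by rewrite derivD !derivXn /= !polyCB !polyCM !polyC_natr; ring.
have qk k : (k <= 6)%N -> nth 0 [:: B 1 2%:R; B 1 0; B 1 1 - 2 * B 0 0;
   B 2%:R 0 - 2 * B 0 1; B 2%:R 1; B 1 1 - 5 * B 0 0; 4 * B 2%:R 0 - 7 * B 0 1] k = 0.
  move=> k6; have := q0 k k6; rewrite qE !(coefD, coefN, coefCM, coefC, coefXn, coefX).
  by case: k k6 => [|[|[|[|[|[|[|]]]]]]] //= _ <-; ring.
have /= h0 := qk 0%N isT.
have /= h1 := qk 1%N isT.
have /= h2 := qk 2%N isT.
have /= h3 := qk 3%N isT.
have /= h4 := qk 4%N isT.
have /= h5 := qk 5%N isT.
have /= h6 := qk 6%N isT.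
have b00 : B 0 0 = 0 by lra.
have b11 : B 1 1 = 0 by lra.
have b01 : B 0 1 = 0 by lra.
have b20 : B 2%:R 0 = 0 by lra.
have B0 : B = 0.
  apply/matrixP => i j; rewrite [RHS]mxE.
  have E (k l : 'I_3) : val i = val k -> val j = val l -> B i j = B k l.
    by move=> /val_inj -> /val_inj ->.
  case: i j E => [[|[|[|]]] // ?] [[|[|[|]]] // ?] E.
  - by rewrite (E 0 0).
  - by rewrite (E 0 1).
  - by rewrite (E 0 2%:R).
  - by rewrite (E 1 0).
  - by rewrite (E 1 1).
  - by rewrite (E 1 2%:R).
  - by rewrite (E 2%:R 0).
  - by rewrite (E 2%:R 1).
  - by rewrite (E 2%:R 2%:R).
apply/rowP => l; rewrite mxE.
have ltl := ltn_ord l.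
have := lie_mxE c (inord (l %/ 3)) (inord (l %% 3)).
rewrite -/B B0 mxE !inordK ?ltn_mod//; last by lia.
have -> : (3 * (l %/ 3) + l %% 3 = l)%N by lia.
by rewrite ltl inord_val.
Qed.

Lemma prolong_jcast n m v (z : Jet R m) : (n <= m)%N ->
  prolong v (jcast n z) = jcast n (prolong v z : Jet R m).
Proof.
move=> nm; apply/rowP => i; have [k ->|->] := unliftP ord0 i; last first.
  rewrite prolong0 mxE /=.
  have -> : inord 0 = 0 :> 'I_m.+2 by apply/val_inj; rewrite /= inordK.
  by rewrite prolong0 /xi jcast_trunc.
have ltk := ltn_ord k; have km : (k < m.+1)%N by apply: leq_trans ltk _.
rewrite prolongS [RHS]mxE lift0 ltnS km.
have -> : inord k.+1 = lift ord0 (Ordinal km) :> 'I_m.+2.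
  by apply/val_inj; rewrite /= inordK.
rewrite prolongS; apply: phi_top => /=.
rewrite !jcast_trunc//.
Qed.

(** The 6-jet of the witness has an orbit of full dimension 8, and the
    projections of jet spaces carry generators to generators. *)
Lemma witness_full n : (n <= 6)%N -> orbit_space (witness n) = fullv.
Proof.
move=> n6; apply/eqP; rewrite eqEsubv subvf; apply/subvP => w _.
set M := generator_mx (witness 6).
have rf : row_free M by apply: inj_row_free => c; exact: witness_free.
have uM : M \in unitmx by rewrite -row_free_unit.
apply/orbit_spaceP; exists (jcast 6 (w : Jet R n) *m invmx M).
have E : witness n = jcast n (witness 6) by rewrite /witness jcast_mkjet.
rewrite -prolong_lie_mx E prolong_jcast// prolong_lie_mx -/M -mulmxA mulVmx// mulmx1.
by rewrite jcast_trunc// jcast_id.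
Qed.

Lemma witness_dim n : \dim (orbit_space (witness n)) = minn 8 n.+2.
Proof.
have [n6|n6] := leqP n 6; first by rewrite witness_full// dim_row; lia.
have -> : minn 8 n.+2 = 8 by lia.
by apply/orbit_dim8P; apply: inj_row_free => c; apply: witness_free; exact: ltnW.
Qed.

Lemma generic_orbit_dimE n s : generic_orbit_dim g n s <-> s = minn 8 n.+2.
Proof.
split=> [[[z /orbit_dimE zs] smax]|->].
  apply/eqP; rewrite eqn_leq -{1}zs orbit_space_le /=.
  by apply: smax; apply/orbit_dimE; exact: witness_dim.
split; first by exists (witness n); apply/orbit_dimE; exact: witness_dim.
by move=> z d /orbit_dimE <-; exact: orbit_space_le.
Qed.

Lemma regular_jetE n (z : Jet R n) :
  regular_jet g z <-> \dim (orbit_space z) = minn 8 n.+2.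
Proof.
split=> [[s /generic_orbit_dimE -> /orbit_dimE //]|h].
by exists (minn 8 n.+2); [exact/generic_orbit_dimE|exact/orbit_dimE].
Qed.

(** The differentials of invariants at [p] annihilate the tangent space of the
    orbit. *)
Lemma invariants_le n (p : Jet R n) k :
  has_indep_invariants g p k -> (k + \dim (orbit_space p) <= n.+2)%N.
Proof.
move=> [U [I [_ Up inv ind]]].
pose J : 'M[R]_(k, n.+2) := \matrix_(a < k, i < n.+2) partial i (I a) p.
have rf : row_free J by exact: ind.
pose f : 'Hom('rV[R]_n.+2, 'rV[R]_k) := linfun (mulmxr J^T).
have f_full : limg f = fullv.
  apply/eqP; rewrite eqEsubv subvf; apply/subvP => w _.
  apply/memv_imgP; exists (w *m (pinvmx J)^T); first exact: memvf.
  by rewrite lfunE /= -mulmxA -trmx_mul mulmxVp// trmx1 mulmx1.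
have ker : (orbit_space p <= lker f)%VS.
  apply/subvP => w /orbit_spaceP[c ->]; rewrite memv_ker lfunE /=.
  rewrite -prolong_lie_mx; apply/eqP/rowP => a; rewrite !mxE.
  have [_ /(_ (proj_field (lie_mx c)))] := inv a.
  move=> /(_ (proj2 (generatorP _) (ex_intro _ c erefl)) p Up) H.
  transitivity (prolong_apply (proj_field (lie_mx c)) (I a) p); last exact: H.
  by rewrite /prolong_apply; apply: eq_bigr => i _; rewrite !mxE.
have := limg_ker_dim f fullv; rewrite capfv f_full !dim_row => D.
by rewrite -[leqRHS]D addnC leq_add2r; exact: dimvS.
Qed.

Lemma inv_number_small n : (n <= 6)%N -> inv_number g n 0.
Proof.
move=> n6; split; first by exists (witness n); apply/regular_jetE; exact: witness_dim.
move=> p /regular_jetE dp; split; last by move=> k /invariants_le; rewrite dp; lia.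
exists setT, (fun _ _ => 0); split=> //; [exact: openT|by case|].
move=> z _; apply: inj_row_free => c _; apply/rowP; by case.
Qed.

Lemma dimSL3_eq8 : dimSL3 R = 8.
Proof.
rewrite /dimSL3; set f := linfun _.
have fE (A : 'M[R]_3) : f A = \tr A.
  (* a structure of linear map into the one-dimensional space R^o, for lfunE *)
  pose tr : {linear 'M[R]_3 -> R^o} := @mxtrace R 3.
  by rewrite /f -[LHS]/(linfun tr A) lfunE.
have := limg_ker_dim f fullv; rewrite capfv dimvf.
have -> : limg f = fullv.
  apply/eqP; rewrite eqEsubv subvf; apply/subvP => w _.
  apply/memv_imgP; exists ((w : R) / 3)%:M; first exact: memvf.
  have H : w = ((w : R) / 3) *+ 3 :> R by field.
  by rewrite fE mxtrace_scalar -H.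
by rewrite dimvf /dim /=; lia.
Qed.

End OrbitDimension.

(** * The orbits as images of the projective group *)

(** In the echelon factorization of [M], the missing rows of the identity are
    added to the middle factor. *)
Lemma row_free_completion (F : fieldType) m k (M : 'M[F]_(m, m + k)) :
  row_free M -> exists C : 'M[F]_(k, m + k), col_mx M C \in unitmx.
Proof.
move=> /eqP rM.
exists (row_mx 0 1%:M *m row_ebase M).
have -> : col_mx M (row_mx 0 1%:M *m row_ebase M) =
    block_mx (col_ebase M) 0 0 1%:M *m row_ebase M.
  rewrite -{1}(mulmx_ebase M) rM /block_mx mul_col_mx; congr col_mx.
  by rewrite pid_mx_row mul_mx_row mulmx1 mulmx0.
rewrite unitmx_mul row_ebase_unit andbT unitmxE det_ublock det1 mulr1 -unitmxE.
exact: col_ebase_unit.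
Qed.

Section Updates.
Variables (R : realType) (V : finType).

Definition upd (r : V -> R) (o : V) (h : R) : V -> R :=
  fun o' => if o' == o then h else r o'.

Lemma upd_same r o : upd r o (r o) = r.
Proof. by apply/funext => o'; rewrite /upd; case: eqP => // ->. Qed.

Lemma is_derive_upd (e : expr R V) r o : wd e r ->
  is_derive (r o : R^o) 1 ((fun h => eval e (upd r o h)) : R^o -> R^o)
    (eval (der o e) r).
Proof.
move=> we.
have dc v : is_derive (r o : R^o) 1 ((fun h => upd r o h v) : R^o -> R^o) (v == o)%:R.
  rewrite /upd; case: (v == o); first exact: is_derive_id.
  exact: is_derive_cst.
have w' : wd e (upd r o (r o)) by rewrite upd_same.
apply: is_derive_eq (is_derive_eval dc w') _.
rewrite upd_same (bigD1 o)//= eqxx mulr1 big1 ?addr0//.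
by move=> w /negPf ->; rewrite mulr0.
Qed.

Lemma near_eval_neq0 (e : expr R V) r o : wd e r -> eval e r != 0 ->
  \forall h \near (r o : R^o), eval e (upd r o h) != 0.
Proof.
move=> we e0.
have [dv _] := is_derive_upd o we.
have /derivable1_diffP/differentiable_continuous := dv.
by move=> /cvgr_neq0; apply; rewrite upd_same.
Qed.

End Updates.

(** The variables are [None], the parameter t of a curve; the entries a of a
    group element near the identity ([gpar]); and the coordinates sigma along
    an affine section p + sigma C that is transversal to the orbit of p
    ([spar]).  A point of the section is extended to the graph of a polynomial
    with that n-jet, the graph is moved by the group element, and the
    derivatives of the image curve are computed by u_(m+1) = u_(m)' / x'. *)
Section ProjectiveJets.
Variables (R : realType) (k : nat).
Local Notation n := (6 + k)%N.
Variables (p : Jet R n) (C : 'M[R]_(k, n.+2)).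
Local Notation V := (option 'I_n.+2).

Definition gpar (l : 'I_8) : 'I_n.+2 := lshift k l : 'I_(8 + k).
Definition spar (j : 'I_k) : 'I_n.+2 := rshift 8 j : 'I_(8 + k).

Lemma gpar_inj : injective gpar. Proof. exact: (@lshift_inj 8 k). Qed.
Lemma spar_inj : injective spar. Proof. exact: (@rshift_inj 8 k). Qed.
Lemma gspar l j : (gpar l == spar j) = false.
Proof. exact: (eq_lrshift l j). Qed.

(** The group element 1 + a, where a has last entry 0: a chart of the
    projective group at the identity. *)
Definition eA (r c : 'I_3) : expr R V :=
  EAdd (ECst _ (r == c)%:R)
    (if (3 * r + c < 8)%N then EVar R (Some (gpar (inord (3 * r + c)))) else ECst _ 0).

Definition group_mx (r : V -> R) : 'M[R]_3 := 1%:M + lie_mx (\row_l r (Some (gpar l))).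

Lemma eval_eA r i j : eval (eA i j) r = group_mx r i j.
Proof. by rewrite /group_mx /= !mxE lie_mxE; case: ifP => _; rewrite ?mxE. Qed.

(** The i-th coordinate of the point p + sigma C of the section. *)
Definition esec (i : 'I_n.+2) : expr R V :=
  EAdd (ECst _ (p 0 i))
    (esum (enum 'I_k) (fun j => EMul (EVar R (Some (spar j))) (ECst _ (C j i)))).

(** t^j / j!, so that each is the t-derivative of the next. *)
Fixpoint emon (j : nat) : expr R V :=
  if j is j'.+1 then EMul (emon j') (EMul (EVar R None) (ECst _ (j'.+1%:R^-1)))
  else ECst _ 1.

Definition etaylor_mon (m i : nat) : expr R V :=
  if (m <= i)%N then emon (i - m) else ECst _ 0.

(** The m-th derivative, at abscissa x + t, of the polynomial whose n-jet at x is
    the point p + sigma C. *)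
Definition ecurve (m : nat) : expr R V :=
  esum (enum 'I_n.+1) (fun i => EMul (esec (inord i.+1)) (etaylor_mon m i)).

Definition eabs : expr R V := EAdd (esec 0) (EVar R None).

(** The homogeneous coordinates of the image of the point (x + t, f(x + t)). *)
Definition ew (r : 'I_3) : expr R V :=
  EAdd (EAdd (EMul (eA r 0) eabs) (EMul (eA r 1) (ecurve 0))) (eA r 2%:R).

Definition eX : expr R V := EMul (ew 0) (EInv (ew 2%:R)).

Fixpoint eU (m : nat) : expr R V :=
  if m is m'.+1 then EMul (der None (eU m')) (EInv (der None eX))
  else EMul (ew 1) (EInv (ew 2%:R)).

Definition dom (r : V -> R) : Prop :=
  [/\ eval (ew 2%:R) r != 0, eval (der None eX) r != 0 & group_mx r \in unitmx].

Lemma wd_emon j r : wd (emon j) r.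
Proof. by elim: j => //= j IH; split. Qed.

Lemma wd_esec i r : wd (esec i) r.
Proof. by split=> //; apply: wd_esum => j. Qed.

Lemma wd_ecurve m r : wd (ecurve m) r.
Proof.
apply: wd_esum => i; split; first exact: wd_esec.
by rewrite /etaylor_mon; case: ifP => // _; exact: wd_emon.
Qed.

Lemma wd_eA i j r : wd (eA i j) r.
Proof. by split=> //; case: ifP. Qed.

Lemma wd_ew i r : wd (ew i) r.
Proof.
split; last exact: wd_eA.
by split; split; try exact: wd_eA; [split=> //; exact: wd_esec|exact: wd_ecurve].
Qed.

Lemma wd_eX r : eval (ew 2%:R) r != 0 -> wd eX r.
Proof. by move=> h; split; [exact: wd_ew|split=> //; exact: wd_ew]. Qed.

Lemma wd_eU m r : eval (ew 2%:R) r != 0 -> eval (der None eX) r != 0 -> wd (eU m) r.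
Proof.
move=> h1 h2; elim: m => [|m IH].
  by split; [exact: wd_ew|split=> //; exact: wd_ew].
split; first exact: wd_der.
by split=> //; apply: wd_der; exact: wd_eX.
Qed.

Definition ejet m (r : V -> R) : Jet R m := mkjet m (eval eX r) (fun j => eval (eU j) r).

Lemma group_mx_upd r h : group_mx (upd r None h) = group_mx r.
Proof. by congr (_ + lie_mx _); apply/rowP => l; rewrite !mxE. Qed.

Lemma near_dom r : dom r -> \forall h \near (r None : R^o), dom (upd r None h).
Proof.
move=> [h1 h2 h3].
have n1 := near_eval_neq0 None (wd_ew _ r) h1.
have n2 := near_eval_neq0 None (wd_der None (wd_eX h1)) h2.
by apply: filterS2 n1 n2 => h ? ?; split=> //; rewrite group_mx_upd.
Qed.

Lemma eval_der_gpar_mon l j r : eval (der (Some (gpar l)) (emon j)) r = 0.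
Proof. by elim: j => //= j ->; rewrite !mul0r mulr0 addr0 !mulr0 addr0. Qed.

Lemma eval_der_gpar_sec l i r : eval (der (Some (gpar l)) (esec i)) r = 0.
Proof.
rewrite /= add0r der_esum eval_esum big1_seq// => j _ /=.
by rewrite mulr0 addr0 (inj_eq Some_inj) eq_sym gspar mul0r.
Qed.

Lemma eval_der_gpar_curve l m r : eval (der (Some (gpar l)) (ecurve m)) r = 0.
Proof.
rewrite /ecurve der_esum eval_esum big1_seq// => i _.
have -> : eval (der (Some (gpar l)) (EMul (esec (inord i.+1)) (etaylor_mon m i))) r =
  eval (der (Some (gpar l)) (esec (inord i.+1))) r * eval (etaylor_mon m i) r
  + eval (esec (inord i.+1)) r * eval (der (Some (gpar l)) (etaylor_mon m i)) r by [].
rewrite eval_der_gpar_sec mul0r add0r /etaylor_mon.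
by case: ifP => _ /=; rewrite ?eval_der_gpar_mon mulr0.
Qed.

Lemma eval_der_gpar_A l i j r : eval (der (Some (gpar l)) (eA i j)) r = lie_basis R l i j.
Proof.
have -> : lie_basis R l = lie_mx (delta_mx 0 l).
  rewrite /lie_mx (bigD1 l)//= mxE !eqxx scale1r big1 ?addr0// => l' /negPf nl.
  by rewrite mxE eqxx nl scale0r.
rewrite lie_mxE /= add0r; case: ifP => _ //=.
by rewrite mxE eqxx (inj_eq Some_inj) (inj_eq gpar_inj).
Qed.

(** Increasing the parameter a_l by epsilon multiplies the group element A on
    the left by 1 + epsilon E_l A^-1. *)
Definition velocity_mx l (r : V -> R) : 'M[R]_3 := lie_basis R l *m invmx (group_mx r).

Lemma eval_der_gpar_w l i r : dom r ->
  eval (der (Some (gpar l)) (ew i)) r =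
  eval (ew 2%:R) r * affine_row (velocity_mx l r) i (eval eX r) (eval (eU 0) r).
Proof.
move=> [w2 _ uA].
pose Q : 'cV[R]_3 := \col_c [:: eval eabs r; eval (ecurve 0) r; 1]`_c.
pose W : 'cV[R]_3 := \col_c eval (ew c) r.
have sum3 (f : 'I_3 -> R) : \sum_c f c = f 0 + f 1 + f 2%:R.
  rewrite !big_ord_recl big_ord0 addr0 addrA.
  by congr (_ + f _ + f _); apply/val_inj.
have Q0 : Q 0 0 = eval eabs r by rewrite mxE.
have Q1 : Q 1 0 = eval (ecurve 0) r by rewrite mxE.
have Q2 : Q 2%:R 0 = 1 by rewrite mxE.
have AQ : group_mx r *m Q = W.
  by apply/colP => c; rewrite [LHS]mxE [RHS]mxE sum3 Q0 Q1 Q2 -!eval_eA mulr1.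
have EQ : lie_basis R l *m Q = velocity_mx l r *m W by rewrite -AQ mulmxA mulmxKV.
transitivity ((lie_basis R l *m Q) i 0).
  rewrite mxE sum3 Q0 Q1 Q2 -!(eval_der_gpar_A l _ _ r).
  have dq : eval (der (Some (gpar l)) eabs) r = 0.
    by rewrite -[LHS]/(eval (der (Some (gpar l)) (esec 0)) r + 0) eval_der_gpar_sec addr0.
  have -> : eval (der (Some (gpar l)) (ew i)) r =
    eval (der (Some (gpar l)) (eA i 0)) r * eval eabs r
    + eval (eA i 0) r * eval (der (Some (gpar l)) eabs) r
    + (eval (der (Some (gpar l)) (eA i 1)) r * eval (ecurve 0) r
    + eval (eA i 1) r * eval (der (Some (gpar l)) (ecurve 0)) r)
    + eval (der (Some (gpar l)) (eA i 2%:R)) r by [].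
  by rewrite dq eval_der_gpar_curve !mulr0 !addr0 mulr1.
rewrite EQ mxE sum3 ![W _ _]mxE /affine_row.
rewrite -[eval eX r]/(eval (ew 0) r * (eval (ew 2%:R) r)^-1).
rewrite -[eval (eU 0) r]/(eval (ew 1) r * (eval (ew 2%:R) r)^-1).
by field.
Qed.

Lemma xi_ejet B m r : xi (proj_field B) (ejet m r) =
  affine_row B 0 (eval eX r) (eval (eU 0) r)
  - eval eX r * affine_row B 2%:R (eval eX r) (eval (eU 0) r).
Proof. by rewrite xi_proj_field xcoord_mkjet ucoord_mkjet. Qed.

Lemma eval_der_gpar_X l r : dom r ->
  eval (der (Some (gpar l)) eX) r = xi (proj_field (velocity_mx l r)) (ejet 0 r).
Proof.
move=> dr; have [w2 _ _] := dr; rewrite xi_ejet.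
have -> : eval (der (Some (gpar l)) eX) r =
  eval (der (Some (gpar l)) (ew 0)) r * (eval (ew 2%:R) r)^-1
  + eval (ew 0) r * ((-1) * eval (der (Some (gpar l)) (ew 2%:R)) r
     * ((eval (ew 2%:R) r)^-1 * (eval (ew 2%:R) r)^-1)) by [].
rewrite !eval_der_gpar_w// -[eval eX r]/(eval (ew 0) r * (eval (ew 2%:R) r)^-1).
by field.
Qed.

Lemma eval_eUS m r :
  eval (eU m.+1) r = eval (der None (eU m)) r * (eval (der None eX) r)^-1.
Proof. by []. Qed.

(** The jet of the image curve moves, under a change of the group element, with
    the velocity of a prolonged generator.  Write d for the derivative in a_l
    and a prime for the derivative in t.  From u_(m+1) = u_(m)' / x' and the
    commutation of the two derivatives, d u_(m+1) is
    (d u_(m))' / x' - u_(m+1) (d x)' / x'.  By induction d u_(m) is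
    D_x^m Q + xi u_(m+1), and d x = xi; differentiating along the image curve
    turns this into D_x^(m+1) Q + xi u_(m+2).  The generator does not depend
    on t because the group element does not. *)
Theorem eval_der_gpar_U l m r : dom r ->
  eval (der (Some (gpar l)) (eU m)) r = phi (proj_field (velocity_mx l r)) (ejet m.+1 r).
Proof.
elim: m r => [|m IH] r dr; have [w2 Xt _] := dr.
  rewrite /phi [DQ _ _]/= characteristic_proj_field subrK xcoord_mkjet ucoord_mkjet//.
  have -> : eval (der (Some (gpar l)) (eU 0)) r =
    eval (der (Some (gpar l)) (ew 1)) r * (eval (ew 2%:R) r)^-1
    + eval (ew 1) r * ((-1) * eval (der (Some (gpar l)) (ew 2%:R)) r
     * ((eval (ew 2%:R) r)^-1 * (eval (ew 2%:R) r)^-1)) by [].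
  rewrite !eval_der_gpar_w// -[eval (eU 0) r]/(eval (ew 1) r * (eval (ew 2%:R) r)^-1).
  by field.
set B := velocity_mx l r; set t := r None.
have wX := wd_eX w2; have wU j := wd_eU j w2 Xt.
set xt := eval (der None eX) r.
have dX := is_derive_upd None wX.
have dU j : is_derive (t : R^o) 1 ((fun h => eval (eU j) (upd r None h)) : R^o -> R^o)
     (eval (eU j.+1) (upd r None t) * xt).
  apply: is_derive_eq (is_derive_upd None (wU j)) _.
  by rewrite upd_same eval_eUS mulfVK.
have dDQ := is_derive_DQ_curve B m dX dU.
set xl := der (Some (gpar l)) eX.
have dxl := is_derive_upd None (wd_der (Some (gpar l)) wX).
have G1 := is_derive_upd None (wd_der (Some (gpar l)) (wU m)).
have G2 : is_derive (t : R^o) 1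
  ((fun h => eval (der (Some (gpar l)) (eU m)) (upd r None h)) : R^o -> R^o)
  (xt * DQ (proj_field B) (ejet m.+2 r)
   + (eval xl r * (eval (eU m.+2) r * xt) + eval (eU m.+1) r * eval (der None xl) r)).
  apply: (@near_eq_is_derive _ _ _
    ((fun h => DQ (proj_field B) (ejet m.+1 (upd r None h))
       + eval xl (upd r None h) * eval (eU m.+1) (upd r None h)) : R^o -> R^o)).
    apply: filterS (near_dom dr) => h dh.
    have EB : velocity_mx l (upd r None h) = B by rewrite /velocity_mx group_mx_upd.
    rewrite IH// EB /phi; congr (_ + _ * _); last by rewrite ucoord_mkjet.
    by rewrite /xl eval_der_gpar_X// EB !xi_ejet.
  apply: is_derive_eq (is_deriveD dDQ (is_deriveM dxl (dU m.+1))) _.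
  by rewrite upd_same.
have := is_derive_uniq G1 G2; rewrite der_comm -/t => G.
have -> : eval (der (Some (gpar l)) (eU m.+1)) r =
  eval (der (Some (gpar l)) (der None (eU m))) r * xt^-1
  + eval (der None (eU m)) r *
   ((-1) * eval (der (Some (gpar l)) (der None eX)) r * (xt^-1 * xt^-1)) by [].
rewrite G (der_comm _ _ eX).
have -> : eval (der None (eU m)) r = eval (eU m.+1) r * xt by rewrite eval_eUS mulfVK.
rewrite /phi ucoord_mkjet// -/B.
have -> : xi (proj_field B) (ejet m.+2 r) = eval xl r.
  by rewrite /xl eval_der_gpar_X// !xi_ejet.
by rewrite -/xl; field.
Qed.


(** * The chart of a neighbourhood of a regular jet *)

(** The group element is the identity. *)
Definition flat (r : V -> R) : Prop := forall l, r (Some (gpar l)) = 0.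

Lemma flat_upd r o h : flat r -> (forall l, o != Some (gpar l)) -> flat (upd r o h).
Proof. by move=> fr ol l; rewrite /upd eq_sym (negPf (ol l)) fr. Qed.

(** Directions other than those of the group parameters preserve [flat], so
    expressions that agree there have the same derivatives along them. *)
Lemma flat_der (e1 e2 : expr R V) :
  (forall r, flat r -> [/\ wd e1 r, wd e2 r & eval e1 r = eval e2 r]) ->
  forall r o, flat r -> (forall l, o != Some (gpar l)) ->
  eval (der o e1) r = eval (der o e2) r.
Proof.
move=> H r o fr ol; have [w1 w2 _] := H r fr.
apply: is_derive_uniq (is_derive_upd o w1) _.
have -> : (fun h => eval e1 (upd r o h)) = (fun h => eval e2 (upd r o h)).
  by apply/funext => h; have [] := H _ (flat_upd h fr ol).
exact: is_derive_upd.
Qed.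

Lemma group_mx_flat r : flat r -> group_mx r = 1%:M.
Proof.
move=> fr; rewrite /group_mx; have -> : \row_l r (Some (gpar l)) = 0.
  by apply/rowP => l; rewrite !mxE.
by rewrite /lie_mx big1 ?addr0// => l _; rewrite mxE scale0r.
Qed.

Lemma ew_flat i r : flat r -> eval (ew i) r = [:: eval eabs r; eval (ecurve 0) r; 1]`_i.
Proof.
move=> fr.
have -> : eval (ew i) r = eval (eA i 0) r * eval eabs r
  + eval (eA i 1) r * eval (ecurve 0) r + eval (eA i 2%:R) r by [].
rewrite !eval_eA (group_mx_flat fr) !mxE.
by case: i => [[|[|[|]]]] //= ?; rewrite ?mulr1n ?mulr0n; ring.
Qed.

Lemma eX_flat r : flat r -> [/\ wd eX r, wd eabs r & eval eX r = eval eabs r].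
Proof.
move=> fr; have w2 : eval (ew 2%:R) r = 1 by rewrite ew_flat.
split; first by apply: wd_eX; rewrite w2 oner_neq0.
  by split=> //; exact: wd_esec.
by rewrite -[LHS]/(eval (ew 0) r * (eval (ew 2%:R) r)^-1) w2 invr1 mulr1 ew_flat.
Qed.

Lemma der_sec_None i r : eval (der None (esec i)) r = 0.
Proof.
rewrite /= add0r der_esum eval_esum big1_seq// => j _ /=.
by rewrite mul0r add0r mulr0.
Qed.

Lemma der_mon_None j r : eval (der None (emon j.+1)) r = eval (emon j) r.
Proof.
elim: j => [|j IH]; first by rewrite /=; field.
have -> : eval (der None (emon j.+2)) r =
  eval (der None (emon j.+1)) r * (r None * j.+2%:R^-1)
  + eval (emon j.+1) r * (1 * j.+2%:R^-1 + r None * 0) by [].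
rewrite IH -[eval (emon j.+1) r]/(eval (emon j) r * (r None * j.+1%:R^-1)).
field; have := ler0n R j; rewrite -?natr1 => j0.
by apply/andP; split; apply: lt0r_neq0; lra.
Qed.

Lemma der_curve_None m r : eval (der None (ecurve m)) r = eval (ecurve m.+1) r.
Proof.
rewrite /ecurve der_esum !eval_esum; apply: eq_bigr => i _.
have -> : eval (der None (EMul (esec (inord i.+1)) (etaylor_mon m i))) r =
  eval (der None (esec (inord i.+1))) r * eval (etaylor_mon m i) r
  + eval (esec (inord i.+1)) r * eval (der None (etaylor_mon m i)) r by [].
rewrite der_sec_None mul0r add0r.
have -> : eval (EMul (esec (inord i.+1)) (etaylor_mon m.+1 i)) r =
  eval (esec (inord i.+1)) r * eval (etaylor_mon m.+1 i) r by [].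
congr (_ * _); rewrite /etaylor_mon; have [mi|mi|<-] := ltngtP m i => //.
  by rewrite -subnSK// der_mon_None.
by rewrite subnn.
Qed.

Lemma derX_flat r : flat r -> eval (der None eX) r = 1.
Proof.
move=> fr; rewrite (flat_der eX_flat)//.
by rewrite -[LHS]/(eval (der None (esec 0)) r + 1) der_sec_None add0r.
Qed.

Lemma dom_flat r : flat r -> dom r.
Proof.
move=> fr; split; first by rewrite ew_flat// oner_neq0.
  by rewrite derX_flat// oner_neq0.
by rewrite group_mx_flat// unitmx1.
Qed.

Lemma eU_flat m r : flat r -> [/\ wd (eU m) r, wd (ecurve m) r & eval (eU m) r = eval (ecurve m) r].
Proof.
elim: m r => [|m IH] r fr; have [w2 Xt _] := dom_flat fr.
  split; [exact: wd_eU|exact: wd_ecurve|].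
  rewrite -[LHS]/(eval (ew 1) r * (eval (ew 2%:R) r)^-1).
  by rewrite !ew_flat// invr1 mulr1.
split; [exact: wd_eU|exact: wd_ecurve|].
by rewrite eval_eUS derX_flat// invr1 mulr1 (flat_der IH)// der_curve_None.
Qed.

Lemma emon0 j r : r None = 0 -> eval (emon j) r = (j == 0)%:R.
Proof. by move=> r0; elim: j => //= j IH; rewrite r0 mul0r mulr0. Qed.

Lemma etaylor_mon0 m i r : r None = 0 -> eval (etaylor_mon m i) r = (m == i)%:R.
Proof.
move=> r0; rewrite /etaylor_mon; case: ltngtP => [mi|mi|->] //.
  by rewrite emon0// subn_eq0 leqNgt mi.
by rewrite emon0// subnn.
Qed.

Lemma der_mon_spar j i r : eval (der (Some (spar j)) (emon i)) r = 0.
Proof. by elim: i => //= i ->; rewrite !mul0r mulr0 addr0 !mulr0 addr0. Qed.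

Lemma der_sec_spar j i r : eval (der (Some (spar j)) (esec i)) r = C j i.
Proof.
rewrite /= add0r der_esum eval_esum big_enum/= (bigD1 j)//= big1 => [|j' /negPf nj].
  by rewrite mulr0 !addr0 eqxx mul1r.
by rewrite mulr0 addr0 (inj_eq Some_inj) (inj_eq spar_inj) nj mul0r.
Qed.

Lemma curve0 m r : (m <= n)%N -> r None = 0 ->
  eval (ecurve m) r = eval (esec (inord m.+1)) r.
Proof.
move=> mn r0; rewrite /ecurve eval_esum big_enum (bigD1 (inord m))//= big1 => [|i].
  by rewrite inordK// etaylor_mon0// eqxx mulr1 addr0.
rewrite -val_eqE /= inordK// => /negPf im.
by rewrite etaylor_mon0// eq_sym im mulr0.
Qed.

Lemma der_curve_spar j m r : (m <= n)%N -> r None = 0 ->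
  eval (der (Some (spar j)) (ecurve m)) r = C j (inord m.+1).
Proof.
move=> mn r0; rewrite /ecurve der_esum eval_esum.
have E i : eval (der (Some (spar j)) (EMul (esec (inord i.+1)) (etaylor_mon m i))) r =
   C j (inord i.+1) * (m == i)%:R.
  have -> : eval (der (Some (spar j)) (EMul (esec (inord i.+1)) (etaylor_mon m i))) r =
    eval (der (Some (spar j)) (esec (inord i.+1))) r * eval (etaylor_mon m i) r
    + eval (esec (inord i.+1)) r * eval (der (Some (spar j)) (etaylor_mon m i)) r by [].
  rewrite der_sec_spar etaylor_mon0// /etaylor_mon.
  by case: ifP => _ /=; rewrite ?der_mon_spar mulr0 addr0.
under eq_bigr do rewrite E.
rewrite big_enum (bigD1 (inord m))//= big1 => [|i].
  by rewrite inordK// eqxx mulr1 addr0.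
rewrite -val_eqE /= inordK// => /negPf im.
by rewrite eq_sym im mulr0.
Qed.

(** The substitution t := 0. *)
Definition at0 (o : V) : expr R 'I_n.+2 :=
  if o is Some j then EVar R j else ECst _ 0.

Definition env0 (y : 'rV[R]_n.+2) (o : V) : R := eval (at0 o) (rv y).

Definition ecoord (b : 'I_n.+2) : expr R V := if (b : nat) is m.+1 then eU m else eX.

(** The map (a, sigma) |-> A(a) (p + sigma C) into the n-jets.  Its slices of
    constant sigma lie in orbits. *)
Definition orbit_chart (b : 'I_n.+2) : expr R 'I_n.+2 := bind (ecoord b) at0.

Lemma emap_chart y : emap orbit_chart y = ejet n (env0 y).
Proof.
apply/rowP => b; rewrite !mxE /orbit_chart eval_bind /ecoord.
by case: (nat_of_ord b).
Qed.

Lemma wd_chart y : dom (env0 y) -> forall b, wd (orbit_chart b) (rv y).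
Proof.
move=> [w2 Xt _] b; apply: wd_bind => [[j|]|] //.
rewrite /ecoord; case: (nat_of_ord b) => [|m]; first exact: wd_eX.
exact: wd_eU.
Qed.

Lemma ejac_chart y j b :
  ejac orbit_chart y j b = eval (der (Some j) (ecoord b)) (env0 y).
Proof.
rewrite mxE der_bind (bigD1 (Some j))//= eqxx mulr1 big1 ?addr0// => -[i|] //=.
  by rewrite (inj_eq Some_inj) => /negPf ->; rewrite mulr0.
by rewrite mulr0.
Qed.

Lemma jcast_ejet m m' r : (m <= m')%N -> jcast m (ejet m' r) = ejet m r.
Proof. exact: jcast_mkjet. Qed.

Lemma ejac_gpar y l : dom (env0 y) ->
  row (gpar l) (ejac orbit_chart y) = prolong (proj_field (velocity_mx l (env0 y))) (emap orbit_chart y).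
Proof.
move=> dy; apply/rowP => b; rewrite mxE ejac_chart emap_chart.
have [m ->|->] := unliftP ord0 b.
  have mn : (m <= n)%N by rewrite -ltnS.
  rewrite prolongS /ecoord /= eval_der_gpar_U//; apply: phi_top.
  by rewrite jcast_trunc// !jcast_ejet.
by rewrite prolong0 -[ecoord _]/eX eval_der_gpar_X// !xi_ejet.
Qed.

Lemma env0_0 : flat (env0 0).
Proof. by move=> l; rewrite /env0 /= /rv mxE. Qed.

Lemma env0_None y : env0 y None = 0. Proof. by []. Qed.

Lemma esec0 i : eval (esec i) (env0 0) = p 0 i.
Proof.
rewrite /= eval_esum big1_seq ?addr0// => j _ /=.
by rewrite /env0 /= /rv mxE mul0r.
Qed.

Lemma emap_chart0 : emap orbit_chart 0 = p.
Proof.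
rewrite emap_chart; apply/rowP => b; rewrite mxE.
have [m ->|->] := unliftP ord0 b.
  rewrite lift0; have [_ _ ->] := eU_flat m env0_0.
  have mn : (m <= n)%N by rewrite -ltnS.
  rewrite (curve0 mn (env0_None 0)) esec0; congr (p 0 _).
  by apply/val_inj; rewrite /= inordK// ltnS.
have [_ _ ->] := eX_flat env0_0.
by rewrite -[LHS]/(eval (esec 0) (env0 0) + 0) addr0 esec0.
Qed.

Lemma ejac_gpar0 l : row (gpar l) (ejac orbit_chart 0) = row l (generator_mx p).
Proof.
rewrite ejac_gpar; last exact/dom_flat/env0_0.
by rewrite emap_chart0 rowK /velocity_mx group_mx_flat ?invmx1 ?mulmx1//; exact: env0_0.
Qed.

Lemma ejac_spar0 j : row (spar j) (ejac orbit_chart 0) = row j C.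
Proof.
apply/rowP => b; rewrite mxE ejac_chart [RHS]mxE.
have ns l : Some (spar j) != Some (gpar l) :> V.
  by rewrite (inj_eq Some_inj) eq_sym gspar.
have [m ->|->] := unliftP ord0 b; last rewrite -[ecoord _]/eX.
  rewrite /ecoord lift0 (flat_der (eU_flat m))//; last exact: env0_0.
  have mn : (m <= n)%N by rewrite -ltnS.
  rewrite (der_curve_spar _ mn (env0_None 0)); congr (C j _).
  by apply/val_inj; rewrite /= inordK// ltnS.
rewrite (flat_der eX_flat)//; last exact: env0_0.
by rewrite -[LHS]/(eval (der (Some (spar j)) (esec 0)) (env0 0) + 0) addr0 der_sec_spar.
Qed.

Hypothesis unitC : (col_mx (generator_mx p : 'M[R]_(8, 8 + k)) C : 'M[R]_(8 + k, 8 + k)) \in unitmx.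

Lemma ejac0_unit : ejac orbit_chart 0 \in unitmx.
Proof.
suff -> : ejac orbit_chart 0 = col_mx (generator_mx p : 'M[R]_(8, 8 + k)) C by [].
apply/row_matrixP => i; have [l ->|j ->] := @split_ordP 8 k i.
  by rewrite [RHS](@rowKu _ 8 k) -ejac_gpar0.
by rewrite [RHS](@rowKd _ 8 k) -ejac_spar0.
Qed.

Lemma regular_chart0 : regular_pt orbit_chart 0.
Proof. by split; [exact/wd_chart/dom_flat/env0_0|exact: ejac0_unit]. Qed.

Lemma nbhs_dom : nbhs (0 : 'rV[R]_n.+2) [set y | dom (env0 y)].
Proof.
have cenv o : (fun y : 'rV[R]_n.+2 => env0 y o : R^o) @ nbhs (0 : 'rV[R]_n.+2)
    --> (env0 0 o : R^o).
  case: o => [j|]; last exact: cvg_cst.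
  exact: (@cvg_coord _ _ _ _ _ id 0 j).
have [w2 Xt uA] := dom_flat env0_0.
have n1 : \forall y \near (0 : 'rV[R]_n.+2), eval (ew 2%:R) (env0 y) != 0.
  exact: (cvgr_neq0 _ (cvg_eval cenv (wd_ew 2%:R _)) w2).
have n2 : \forall y \near (0 : 'rV[R]_n.+2), eval (der None eX) (env0 y) != 0.
  exact: (cvgr_neq0 _ (cvg_eval cenv (wd_der None (wd_eX w2))) Xt).
have cA i j : (fun y : 'rV[R]_n.+2 => group_mx (env0 y) i j : R^o) @ nbhs (0 : 'rV[R]_n.+2)
    --> (group_mx (env0 0) i j : R^o).
  under eq_fun do rewrite -eval_eA.
  rewrite -eval_eA; apply: cvg_eval => //; exact: wd_eA.
have [n3 _] := cvg_invmx uA cA.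
by apply: filterS3 n1 n2 n3 => y ? ? ?; split.
Qed.

(** The coordinates sigma of the inverse of the chart are the invariants: the
    rows of the Jacobian matrix of the chart that belong to the group parameters
    are generators.  As these eight rows are independent, they span all the
    generators, hence the gradients of the sigma annihilate every generator.
    Those gradients are independent as columns of an invertible matrix. *)
Theorem invariants_exist : has_indep_invariants (@sl3_generators R) p k.
Proof.
have [U [chi [oU Up H]]] := local_inverse regular_chart0 nbhs_dom.
rewrite emap_chart0 in Up.
pose D z := ejac orbit_chart (chi z); pose K z := invmx (D z).
exists U, (fun a z => chi z 0 (spar a)); split=> //.
- move=> a; split.
    apply: (smooth_chi (Psi := orbit_chart) (chi := chi) oU _ _ _ (e := EVar R (spar a))) => //.
    + by move=> z /H[].
    + by move=> z /H[].
    + by move=> z /H[].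
  move=> v /generatorP[c ->] z Uz; have [dz [_ uD] cz _ dchi] := H z Uz.
  have -> : prolong_apply (proj_field (lie_mx c)) (fun z => chi z 0 (spar a)) z =
     (prolong (proj_field (lie_mx c)) z *m K z) 0 (spar a).
    rewrite mxE; apply: eq_bigr => i _; congr (_ * _).
    by have [_ <-] := dchi i (spar a).
  rewrite prolong_lie_mx.
  (* T expresses the eight group rows of the Jacobian matrix in the generators *)
  pose T := \matrix_l xget 0 [set c | proj_field (velocity_mx l (env0 (chi z))) = proj_field (lie_mx c)].
  have rowsE l : row (gpar l) (D z) = row l T *m generator_mx z.
    rewrite ejac_gpar// cz -prolong_lie_mx rowK.
    suff <- : proj_field (velocity_mx l (env0 (chi z))) = proj_field (lie_mx (xget 0
      [set c | proj_field (velocity_mx l (env0 (chi z))) = proj_field (lie_mx c)])) by [].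
    have [c' h] := proj_field_lie_mx (velocity_mx l (env0 (chi z))).
    by case: xgetP => [x _ //|/(_ c')] /(_ h).
  have TGK i j : (T *m generator_mx z *m K z) i j = (1%:M : 'M[R]_n.+2) (gpar i) j.
    rewrite -(mulmxV uD) !mxE; apply: eq_bigr => s _; congr (_ * _).
    by move: (rowsE i) => /rowP/(_ s); rewrite -row_mul !mxE.
  have uT : T \in unitmx.
    pose Kg : 'M[R]_(n.+2, 8) := \matrix_(i, l) K z i (gpar l).
    have : T *m (generator_mx z *m Kg) = 1%:M.
      apply/matrixP => i l; rewrite mulmxA.
      transitivity ((T *m generator_mx z *m K z) i (gpar l)).
        by rewrite mxE [RHS]mxE; apply: eq_bigr => s _; rewrite [Kg _ _]mxE.
      by rewrite TGK !mxE (inj_eq gpar_inj).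
    by move/mulmx1_unit => [].
  pose Ks : 'cV[R]_n.+2 := col (spar a) (K z).
  have TGKs : T *m (generator_mx z *m Ks) = 0.
    apply/colP => i; rewrite mulmxA.
    transitivity ((T *m generator_mx z *m K z) i (spar a)).
      by rewrite mxE [RHS]mxE; apply: eq_bigr => s _; rewrite [Ks _ _]mxE.
    by rewrite TGK !mxE gspar.
  have GKs : generator_mx z *m Ks = 0.
    by rewrite -(mulKmx uT (generator_mx z *m Ks)) TGKs mulmx0.
  transitivity ((c *m (generator_mx z *m Ks)) 0 0); last by rewrite GKs mulmx0 mxE.
  by rewrite mulmxA mxE [RHS]mxE; apply: eq_bigr => s _; rewrite [Ks _ _]mxE.
- move=> z Uz; have [_ [_ uD] _ _ dchi] := H z Uz.
  apply/row_freeP; exists (\matrix_(i, b) D z (spar b) i).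
  apply/matrixP => a b; transitivity ((D z *m K z) (spar b) (spar a)).
    rewrite !mxE; apply: eq_bigr => i _; rewrite !mxE mulrC; congr (_ * _).
    by have [_ <-] := dchi i (spar a).
  by rewrite mulmxV// !mxE (inj_eq spar_inj) eq_sym.
Qed.

End ProjectiveJets.

(** * The numbers attached to the action *)

Section InvariantNumbers.
Variable R : realType.
Local Notation g := (@sl3_generators R).

(** With truncated subtraction, the formula covers all orders. *)
Lemma inv_numberE n : inv_number g n (n - 6).
Proof.
have [n6|/ltnW n6] := leqP n 6.
  have -> : (n - 6 = 0)%N by lia.
  exact: inv_number_small.
split; first by exists (witness R n); apply/regular_jetE; exact: witness_dim.
have [k ->] : exists k, n = (6 + k)%N by exists (n - 6)%N; rewrite subnKC.
rewrite addKn => p /regular_jetE dp.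
have d8 : (\dim (orbit_space p) = 8)%N by rewrite dp; lia.
split; last by move=> l /invariants_le; rewrite d8; lia.
have [C uC] := row_free_completion (k := k) ((orbit_dim8P p).1 d8).
exact: invariants_exist uC.
Qed.

Lemma strict_inv_numberE n :
  strict_inv_number g n (if (n <= 6)%N then 0 else 1).
Proof.
case: n => [|m]; first by exists 0%N => //; exact: (inv_numberE 0).
exists (m.+1 - 6)%N, (m - 6)%N; split; try exact: inv_numberE.
case: ifP => h.
  have -> : (m.+1 - 6 = m - 6)%N by lia.
  by rewrite subrr.
have -> : (m.+1 - 6 = (m - 6).+1)%N by lia.
by rewrite -addn1 PoszD addrAC subrr add0r.
Qed.

Lemma isotropy_dimE n : isotropy_dim g (dimSL3 R) n (8%:Z - (minn 8 n.+2)%:Z).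
Proof. by exists (minn 8 n.+2); [exact/generic_orbit_dimE|rewrite dimSL3_eq8]. Qed.

End InvariantNumbers.

Theorem mainTheorem2 (R : realType) :
  let g := @sl3_generators R in
  let i_ := inv_number g in
  let j_ := strict_inv_number g in
  let s_ := generic_orbit_dim g in
  let h_ := isotropy_dim g (dimSL3 R) in
  (forall v : vfield R, g v <-> spanned_by_fields (sl3_fields R) v) /\
  ((forall n : nat, (n <= 6)%N -> i_ n 0%N) /\
   (forall n : nat, (7 <= n)%N -> i_ n (n - 6)%N)) /\
  ((forall n : nat, (n <= 6)%N -> j_ n 0) /\
   (forall n : nat, (7 <= n)%N -> j_ n 1)) /\
  (s_ 0%N 2%N /\ s_ 1%N 3%N /\ s_ 2%N 4%N /\
   s_ 3%N 5%N /\ s_ 4%N 6%N /\ s_ 5%N 7%N) /\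
  (h_ 0%N 6 /\ h_ 1%N 5 /\ h_ 2%N 4 /\ h_ 3%N 3 /\ h_ 4%N 2 /\ h_ 5%N 1 /\
   (forall n : nat, (6 <= n)%N -> h_ n 0)).
Proof.
move=> g i_ j_ s_ h_; split.
  by move=> v; split=> [/sl3_generatorsE|/spanned_sl3E] H; [apply/spanned_sl3E|apply/sl3_generatorsE].
split; first by split=> n hn; [exact: inv_number_small|exact: inv_numberE].
split.
  split=> n hn; have := strict_inv_numberE R n; first by rewrite hn.
  by rewrite leqNgt hn.
have S n := (generic_orbit_dimE R n (minn 8 n.+2)).2 erefl.
split; first by do 5![split; first exact: S]; exact: S.
do 6![split; first exact: isotropy_dimE].
move=> n hn; have := isotropy_dimE R n.
have -> : minn 8 n.+2 = 8 by lia.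
by [].
Qed.
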